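(* Let $M\in\mathrm{Jac}^{g-1}(X)$ and let $\mathcal{E}=(E,\varphi)\in\mathcal{S}^M_T\cap h^{-1}(c)$, with $c=(2a,a^2-b^2)\in B^T_{ni}$ for certain $a\in H^0(X,K)$ and $b\in H^0(X,KT)$. Then: (1) If $E$ is semistable (i.e. $\mathcal{E}$ lies in the complement of $\bigsqcup_{D\in U_b}\mathcal{V}(D)\sqcup\bigsqcup_{D'\in U_b}\mathcal{V}'(D')$), then $\lim_{t\to0}(E,t\varphi)$ is wobbly, that is, $E\in\mathcal{N}$ is wobbly. (2) If $E$ is unstable with maximal destabilizing subbundle $M(-D)\subset E$ (resp. $MT(-D)\subset E$) for some $0<D\in U_b$ (i.e. $\mathcal{E}$ lies in $\mathcal{V}(D)$ (resp. $\mathcal{V}'(D)$) for a non-zero $D\in U_b$), then $\lim_{t\to0}(E,t\varphi)$ is wobbly, that is, the Higgs bundle $$\left(M(-D)\oplus MK^{-1}(D),\begin{pmatrix}0&0\\ s_D^2&0\end{pmatrix}\right)\qquad\left(\text{resp. }\left(MT(-D)\oplus MTK^{-1}(D),\begin{pmatrix}0&0\\ s_D^2&0\end{pmatrix}\right)\right)$$ is wobbly, where $s_D$ is a non-zero section of $\mathcal{O}_X(D)$ with divisor $D$. (3) If $E$ is unstable with maximal destabilizing subbundle $M\subset E$ (resp. $MT\subset E$) (i.e. $\mathcal{E}$ lies in $\mathcal{V}(0)$ (resp. $\mathcal{V}'(0)$)), then $\lim_{t\to0}(E,t\varphi)$ is very stable.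
   Context: $X$ is a smooth projective complex curve of genus $g>1$ with canonical bundle $K$. $\mathcal{N}$ (resp. $\mathcal{M}$) is the moduli space of semistable vector (resp. Higgs) bundles of rank $2$ and degree $0$ on $X$; a Higgs bundle is $(E,\varphi)$ with $\varphi:E\to E\otimes K$, and $\mathcal{N}\subset\mathcal{M}$ via $E\mapsto(E,0)$. The Hitchin map is $h:\mathcal{M}\to B=H^0(X,K)\oplus H^0(X,K^2)$, $h(E,\varphi)=(\mathrm{tr}(\varphi),\det(\varphi))$. $\mathbb{C}^*$ acts on $\mathcal{M}$ by $t\cdot(E,\varphi)=(E,t\varphi)$; limits as $t\to0$ exist in $\mathcal{M}$ and are $\mathbb{C}^*$-fixed. Wobbly and very stable: $E\in\mathcal{N}$ is wobbly if it admits a non-zero nilpotent Higgs field $E\to E\otimes K$, and very stable otherwise. For a $\mathbb{C}^*$-fixed Higgs bundle $(E,\varphi)$, let $W^+_{(E,\varphi)}=\{(E',\varphi')\in\mathcal{M}: \lim_{t\to0}(E',t\varphi')=(E,\varphi)\}$; $(E,\varphi)$ is very stable if it is the only Higgs bundle in $W^+_{(E,\varphi)}$ with nilpotent Higgs field, and wobbly otherwise. $T$ is a fixed non-trivial line bundle with a fixed isomorphism $T^2\cong\mathcal{O}_X$, and $p:X_T\to X$ is the étale double cover it defines (the locus in the total space of $T$ of points with square $1$). For $a\in H^0(X,K)$, $b\in H^0(X,KT)$, put $c=(2a,a^2-b^2)\in B$ ($b^2$ seen as a section of $K^2$). The spectral curve $X_c$ is the zero locus of $(\lambda-a)^2-b^2$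 in the total space $|K|$ ($\lambda$ the tautological section), with projection $\pi_c:X_c\to X$. $B^T\subset B$ is the set of all such $c$, and $B^T_{ni}\subset B^T$ is the subset where $X_c$ is nodal and integral. For $c\in B^T_{ni}$, $\mathrm{div}(b)$ is a reduced effective divisor of degree $2g-2$ with $\mathcal{O}_X(\mathrm{div}(b))\cong KT$, the image of the nodes of $X_c$; the normalization is $\nu_{(a,b)}:X_T\to X_c$, $y\mapsto b(y)+a$. For $c\in B^T_{ni}$, $h^{-1}(c)$ is identified with the compactified Jacobian $\overline{\mathrm{Jac}}^{2g-2}(X_c)$ of rank $1$ torsion-free sheaves of degree $2g-2$, by $\mathcal{F}\mapsto(\pi_{c*}\mathcal{F},\pi_{c*}\lambda)$. For a line bundle $M$ of degree $g-1$ on $X$ ($M\in\mathrm{Jac}^{g-1}(X)$), $\mathcal{S}^M_T\subset\mathcal{M}$ is the closure of the set of Higgs bundles corresponding, over the points $c\in B^T_{ni}$, to line bundles $\mathcal{F}\in\mathrm{Jac}^{2g-2}(X_c)$ with $\nu_{(a,b)}^*\mathcal{F}\cong p^*M$. Recalled fact: for $c\in B^T_{ni}$, $(E,\varphi)\in\mathcal{S}^M_T\cap h^{-1}(c)$ if and only if there is an exact sequence $0\to E\xrightarrow{\Psi}M\oplus MT\to\mathcal{O}_{\mathrm{div}(b)}\to0$ with $(\Psi\otimes1_K)\varphi=\Phi\Psi$, where $\Phi=\begin{pmatrix}a&b\\ b&a\end{pmatrix}$; it is unique up to rescaling $\Psi$. For $\mathcal{E}=(E,\varphi)\in\mathcal{S}^M_T\cap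 h^{-1}(c)$, define the reduced subdivisors of $\mathrm{div}(b)$: $D_\mathcal{E}=\mathrm{supp}\big(M/(\Psi(E)\cap M)\big)$ and $D'_\mathcal{E}=\mathrm{supp}\big(MT/(\Psi(E)\cap MT)\big)$. For $0\le D\le\mathrm{div}(b)$, $\mathcal{V}(D)=\{\mathcal{E}\in\mathcal{S}^M_T\cap h^{-1}(c): D_\mathcal{E}=D\}$ and $\mathcal{V}'(D)=\{\mathcal{E}\in\mathcal{S}^M_T\cap h^{-1}(c): D'_\mathcal{E}=D\}$. Let $U_b$ be the set of divisors $D$ with $0\le D\le\mathrm{div}(b)$ and $\deg(D)<g-1$.
   Formalization: In (1) the hypothesis is ''E semistable''; of the gloss ''i.e. E lies in the complement of the V(D), V'(D')'' only semistable implies complement is proved, since the converse fails in general for g at least 4 (a destabilizing line may lie in neither M nor MT). *)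

(* Defs.v *)
From HB Require Import structures.
From mathcomp Require Import all_boot all_order all_algebra.
From mathcomp Require Import boolp classical_sets reals.
From mathcomp Require Import complex freeg.

Set Implicit Arguments.
Unset Strict Implicit.
Unset Printing Implicit Defensive.

Import Order.TTheory GRing.Theory Num.Theory.
Local Open Scope ring_scope.

(** Smooth projective complex curves are presented by their function fields
    (the two categories are equivalent): the points of [X] are the discrete
    valuations of [C(X)] over [C], a line bundle is a subsheaf [O(D)] of the
    constant sheaf [C(X)], and a rank 2 bundle is a family of lattices in
    [C(X)^2].  The complex numbers are [R[i]] for a [realType] [R]. *)

(** [F] is a finite extension of a rational function field [C(x)]. *)
Definition is_function_field (C F : fieldType) (iota : {rmorphism C -> F}) :=
  exists x : F,
    (forall p : {poly C}, p != 0 -> (map_poly iota p).[x] != 0) /\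
    exists (n : nat) (e : 'I_n -> F), forall f : F,
      exists (q : {poly C}) (p : 'I_n -> {poly C}),
        q != 0 /\
        (map_poly iota q).[x] * f = \sum_(i < n) (map_poly iota (p i)).[x] * e i.

Record curve (R : realType) := Curve {
  fun_field : fieldType;
  const : {rmorphism R[i] -> fun_field};
  curve_axiom : is_function_field const }.

Section Points.
Context (R : realType) (X : curve R).
Local Notation F := (fun_field X).

(** [ord 0 = 0] is a junk value, fixed so that a point is determined by its
    valuation. *)
Record point := Point {
  ord : F -> int;
  ord0 : ord 0 = 0;
  ordM : forall f h, f != 0 -> h != 0 -> ord (f * h) = ord f + ord h;
  ordD : forall f h, f != 0 -> h != 0 -> f + h != 0 ->
    Num.min (ord f) (ord h) <= ord (f + h);
  ord_const : forall z : R[i], ord (const X z) = 0;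
  ord_surj : exists f, ord f = 1 }.

HB.instance Definition _ := gen_eqMixin point.
HB.instance Definition _ := gen_choiceMixin point.

Definition ord_ge (v : point) (n : int) (f : F) := f = 0 \/ n <= ord v f.

Definition mx_ord_ge m p (v : point) (n : int) (A : 'M[F]_(m, p)) :=
  forall i j, ord_ge v n (A i j).

Definition mx_ord_eq m p (v : point) (n : int) (A : 'M[F]_(m, p)) :=
  mx_ord_ge v n A /\ exists i j, A i j != 0 /\ ord v (A i j) = n.

Definition uniformizer (v : point) : F := projT1 (cid (ord_surj v)).

Lemma uniformizer_neq0 v : uniformizer v != 0.
Proof.
rewrite /uniformizer; case: cid => f /= hf; apply/eqP => f0.
by move: hf; rewrite f0 ord0.
Qed.

(** Divisors on [X]; [D] also stands for the line bundle [O(D)], whose stalk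
    at [v] is the set of [f] with [ord v f >= - D(v)]. *)
Definition divisor : Type := {freeg point}.

Definition in_stalk (D : divisor) (v : point) (f : F) := ord_ge v (- coeff v D) f.

Definition section (D : divisor) (f : F) := forall v, in_stalk D v f.

Definition effective (D : divisor) := forall v, 0 <= coeff v D.

(** The order of vanishing at [v] of [s] as a section of [O(D)]. *)
Definition zero_div (D : divisor) (s : F) (v : point) : int := ord v s + coeff v D.

Definition has_zero_div (D : divisor) (s : F) (D' : divisor) :=
  s != 0 /\ forall v, zero_div D s v = coeff v D'.

Definition trivial_line (D : divisor) := exists s, has_zero_div D s 0.

(** [K] is the divisor of a non-zero rational differential [w]: if [d] is the
    derivation with [df = d(f) w] and [z] is a uniformizer at [v], then [dz]
    generates the differentials at [v] and [ord_v w = - ord_v (d z)].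
    Sections of [K^n] are the [f] such that [f w^n] is regular. *)
Definition is_canonical (K : divisor) :=
  exists d : F -> F,
    [/\ forall f h, d (f + h) = d f + d h,
        forall f h, d (f * h) = d f * h + f * d h,
        forall z : R[i], d (const X z) = 0,
        exists f, d f != 0
      & forall v z, ord v z = 1 -> ord v (d z) = - coeff v K].

(** The genus is read off from the degree of the canonical bundle, i.e. from
    the Euler characteristic [2 - 2g] of [X]. *)
Definition has_genus (g : nat) (K : divisor) :=
  is_canonical K /\ deg K = 2 * g%:Z - 2.

(** Rank 2 vector bundles: the stalk at [v] is the lattice
    [frame v * O_v^2] in [F^2], equal to [O_v^2] for almost all [v]. *)
Record bundle := Bundle {
  frame : point -> 'M[F]_2;
  frame_unit : forall v, frame v \in unitmx;
  bad : seq point;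
  frame_good : forall v, v \notin bad -> frame v = 1%:M }.

Definition stalk (E : bundle) (v : point) (u : 'cV[F]_2) :=
  mx_ord_ge v 0 (invmx (frame E v) *m u).

Definition bdeg (E : bundle) : int :=
  - \sum_(v <- undup (bad E)) ord v (\det (frame E v)).

(** [f |-> f u] is an isomorphism from [O(L)] onto a saturated subsheaf of
    [E]; every line subbundle of [E] is obtained this way. *)
Definition line_subbundle (E : bundle) (L : divisor) (u : 'cV[F]_2) :=
  u != 0 /\ forall v, mx_ord_eq v (coeff v L) (invmx (frame E v) *m u).

Definition line_quotient (E : bundle) (L : divisor) (r : 'rV[F]_2) :=
  r != 0 /\ forall v, mx_ord_eq v (- coeff v L) (r *m frame E v).

Definition semistable_bundle (E : bundle) :=
  forall L u, line_subbundle E L u -> 2 * deg L <= bdeg E.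

Definition max_destabilizing (E : bundle) (L : divisor) (u : 'cV[F]_2) :=
  [/\ line_subbundle E L u, bdeg E < 2 * deg L
    & forall L' u', line_subbundle E L' u' -> deg L' <= deg L].

Section DirectSum.
Variables L1 L2 : divisor.

Definition dsum_frame (v : point) : 'M[F]_2 :=
  diag_mx (\row_(i < 2)
    uniformizer v ^ (- coeff v (if i == 0 then L1 else L2))).

Lemma dsum_frame_unit v : dsum_frame v \in unitmx.
Proof.
rewrite unitmxE det_diag unitfE; apply/prodf_neq0 => i _.
by rewrite mxE expfz_neq0 ?uniformizer_neq0.
Qed.

Lemma dsum_frame_good v : v \notin dom L1 ++ dom L2 -> dsum_frame v = 1%:M.
Proof.
rewrite mem_cat negb_or => /andP[h1 h2]; rewrite /dsum_frame.
rewrite -diag_const_mx; congr diag_mx; apply/rowP => i; rewrite !mxE.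
by case: (i == 0); rewrite coeff_outdom // oppr0 expr0z.
Qed.

Definition dsum : bundle := Bundle dsum_frame_unit dsum_frame_good.

End DirectSum.

Section Higgs.
Variable K : divisor.

(** Entries of a Higgs field are the coefficients of the chosen rational
    differential with divisor [K]. *)
Definition is_higgs_field (E : bundle) (phi : 'M[F]_2) :=
  forall v, mx_ord_ge v (- coeff v K) (invmx (frame E v) *m phi *m frame E v).

Record higgs := Higgs {
  hbundle :> bundle;
  hfield : 'M[F]_2;
  hfieldP : is_higgs_field hbundle hfield }.

Lemma ord_ge_const v n z (f : F) : ord_ge v n f -> ord_ge v n (const X z * f).
Proof.
case=> [-> | hf]; first by left; rewrite mulr0.
have [-> | f0] := eqVneq f 0; first by left; rewrite mulr0.
have [-> | z0] := eqVneq z 0; first by left; rewrite rmorph0 mul0r.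
by right; rewrite ordM ?fmorph_eq0 // ord_const add0r.
Qed.

Lemma scale_higgsP (t : R[i]) (H : higgs) :
  is_higgs_field H (const X t *: hfield H).
Proof.
move=> v i j; rewrite -scalemxAr -scalemxAl mxE.
exact/ord_ge_const/hfieldP.
Qed.

Definition scale_higgs (t : R[i]) (H : higgs) : higgs := Higgs (scale_higgsP t H).

Lemma zero_higgsP (E : bundle) : is_higgs_field E 0.
Proof. by move=> v i j; left; rewrite mulmx0 mul0mx mxE. Qed.

Definition zero_higgs (E : bundle) : higgs := Higgs (zero_higgsP E).

Definition nilpotent_field (phi : 'M[F]_2) := exists n, phi ^+ n = 0.

Definition semistable_higgs (H : higgs) :=
  forall L u, line_subbundle H L u ->
    (exists a, hfield H *m u = a *: u) -> 2 * deg L <= bdeg H.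

Definition higgs_iso (H H' : higgs) :=
  exists G : 'M[F]_2,
    [/\ G \in unitmx, G *m hfield H = hfield H' *m G
      & forall v u, stalk H v u <-> stalk H' v (G *m u)].

(** [0 -> (O(L1), a1) -> H -> (O(L2), a2) -> 0] is exact. *)
Definition is_extension (H : higgs) (L1 : divisor) (a1 : F) (L2 : divisor) (a2 : F) :=
  exists (u : 'cV[F]_2) (r : 'rV[F]_2),
    [/\ line_subbundle H L1 u, line_quotient H L2 r, r *m u = 0,
        hfield H *m u = a1 *: u & r *m hfield H = a2 *: r].

(** Points of the moduli space [M]: semistable Higgs bundles of rank 2 and
    degree 0, up to S-equivalence. *)
Definition in_moduli (H : higgs) := bdeg H = 0 /\ semistable_higgs H.

Definition s_equivalent (H H' : higgs) :=
  higgs_iso H H' \/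
  exists L1 a1 L2 a2,
    [/\ deg L1 = 0, deg L2 = 0, is_extension H L1 a1 L2 a2
      & is_extension H' L1 a1 L2 a2 \/ is_extension H' L2 a2 L1 a1].

(** [H0] is the fibre at [t = 0] of a family of Higgs bundles on [X x A^1]
    which is [(E, t phi)] for [t != 0].  Such a family is given by a lattice
    [P * F[t]^2] in [F[t, 1/t]^2]; its sections near [(v, 0)] are the [P u],
    with [u] in [F[t]^2], all of whose coefficients are in the stalk of [E],
    and their values at [t = 0] are the [u(0)]. *)
Definition degenerates_to (H H0 : higgs) :=
  exists (P Theta : 'M[{poly F}]_2) (k : nat) (e : F),
    [/\ e != 0, \det P = e *: 'X^k,
        'X *: (map_mx polyC (hfield H) *m P) = P *m Theta,
        hfield H0 = map_mx (coefp 0) Theta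
      & forall v (u0 : 'cV[F]_2), stalk H0 v u0 <->
          exists u : 'cV[{poly F}]_2,
            u0 = map_mx (coefp 0) u /\
            forall n, stalk H v (map_mx (coefp n) (P *m u))].

(** The limit of [t . H] in [M] is the value at [0] of the extension to [A^1]
    of the classifying map of [(E, t phi)], i.e. the S-equivalence class of a
    semistable central fibre. *)
Definition is_limit (H H1 : higgs) :=
  exists H0, [/\ degenerates_to H H0, in_moduli H0 & s_equivalent H0 H1].

Definition Cstar_fixed (H : higgs) :=
  in_moduli H /\ forall t : R[i], t != 0 -> s_equivalent (scale_higgs t H) H.

Definition upward_flow (H0 H : higgs) := in_moduli H /\ is_limit H H0.

Definition only_nilpotent_in_flow (H0 : higgs) :=
  forall H, upward_flow H0 H -> nilpotent_field (hfield H) -> s_equivalent H H0.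

Definition very_stable (H0 : higgs) := Cstar_fixed H0 /\ only_nilpotent_in_flow H0.

Definition wobbly (H0 : higgs) := Cstar_fixed H0 /\ ~ only_nilpotent_in_flow H0.

Definition wobbly_bundle (E : bundle) :=
  [/\ bdeg E = 0, semistable_bundle E
    & exists psi, [/\ psi != 0, is_higgs_field E psi & nilpotent_field psi]].

Definition hitchin (H : higgs) : F * F := (\tr (hfield H), \det (hfield H)).

Definition char_eq (c : F * F) : {poly F} := 'X^2 - c.1 *: 'X + c.2%:P.

(** The spectral curve is flat over [X], so it is integral if and only if its
    generic fibre is. *)
Definition spectral_integral (c : F * F) := irreducible_poly (char_eq c).

(** With a local coordinate [z] at [v] and the induced trivialization of [K],
    the spectral curve near [(v, l)] has equation
    [(y - l)^2 + p (y - l) + q = 0], with [p], [q] functions of [z].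
    It is singular there when [p(0) = q(0) = q'(0) = 0], and the singular
    point is a node when the quadratic part of the equation is nondegenerate,
    i.e. when the order of [p^2 - 4 q] is exactly 2. *)
Definition spectral_nodal (c : F * F) :=
  forall (v : point) (z : F) (l : R[i]), ord v z = 1 ->
    let tr := c.1 * z ^ coeff v K in
    let dt := c.2 * z ^ (2 * coeff v K) in
    let p := 2 * const X l - tr in
    let q := const X l ^+ 2 - tr * const X l + dt in
    ord_ge v 1 p -> ord_ge v 2 q -> ~ ord_ge v 3 (p ^+ 2 - 4 * q).

Section Torsion.
(** [T] is non-trivial and multiplication by [theta] is an isomorphism from
    [T^2] to [O_X]. *)
Variables (T : divisor) (theta : F).

Definition is_2torsion := ~ trivial_line T /\ has_zero_div (- (T + T)) theta 0.

Definition base_point (a b : F) : F * F := (2 * a, a ^+ 2 - theta * b ^+ 2).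

(** [(2a, a^2 - b^2)] lies in [B^T_ni]. *)
Definition in_BTni (a b : F) :=
  [/\ section K a, section (K + T) b,
      spectral_integral (base_point a b) & spectral_nodal (base_point a b)].

Variables (a b : F).

Definition div_b (v : point) : int := zero_div (K + T) b v.

Section Locus.
Variables (M : divisor) (H : higgs).

(** The endomorphism of [M + MT] with matrix [(a, b; b, a)], where
    [b : MT -> M T^2 K] is followed by [T^2 = O_X]. *)
Definition Phi : 'M[F]_2 :=
  \matrix_(i, j) if i == j then a else if i == 0 then theta * b else b.

(** There is an exact sequence [0 -> H -> M + MT -> O_div(b) -> 0], with first
    map [Psi] intertwining the Higgs field with [Phi].  At each [v], the second
    map is induced by a surjective functional [r : (M + MT)_v -> O_v]. *)
Definition spectral_sequence (Psi : 'M[F]_2) :=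
  [/\ Psi \in unitmx, Psi *m hfield H = Phi *m Psi
    & forall v, exists r : 'rV[F]_2,
        mx_ord_eq v 0 (r *m frame (dsum M (M + T)) v) /\
        forall u, stalk H v u <->
          stalk (dsum M (M + T)) v (Psi *m u) /\
          mx_ord_ge v (div_b v) (r *m (Psi *m u))].

(** Membership in the intersection of [S^M_T] with the Hitchin fibre over
    [(2a, a^2 - b^2)], a point of [B^T_ni].  [S^M_T] is a closure in [M] of
    a locus of line bundles on spectral curves; the points of this closure over
    [B^T_ni] are exactly those with a sequence as above. *)
Definition in_SMT :=
  [/\ in_moduli H, hitchin H = base_point a b & exists Psi, spectral_sequence Psi].

(** The inclusions of the generic fibres of [M] ([i = 0]) and [MT] ([i = 1])
    in that of [M + MT]. *)
Definition incl (i : 'I_2) : 'cV[F]_2 := delta_mx i 0.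

Definition summand (i : 'I_2) : divisor := if i == 0 then M else M + T.

(** [D_H] for [i = 0] and [D'_H] for [i = 1]: the reduced divisor supported on
    the points where the image of [H] does not contain the summand. *)
Definition defect_at (Psi : 'M[F]_2) (i : 'I_2) (v : point) :=
  exists f, in_stalk (summand i) v f /\ ~ stalk H v (f *: (invmx Psi *m incl i)).

Definition has_defect (i : 'I_2) (D : divisor) :=
  exists Psi, spectral_sequence Psi /\
    forall v, coeff v D = (`[< defect_at Psi i v >] : nat)%:Z.

Definition in_V (D : divisor) := in_SMT /\ has_defect 0 D.

Definition in_V' (D : divisor) := in_SMT /\ has_defect 1 D.

(** The subsheaf [M(-D)] of [M] (resp. [MT(-D)] of [MT]) is contained in [H]
    and is its maximal destabilizing subbundle. *)
Definition destabilized_by (i : 'I_2) (D : divisor) :=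
  exists Psi, spectral_sequence Psi /\
    max_destabilizing H (summand i - D) (invmx Psi *m incl i).

(** [H] tends to [(L(-D) + L K^-1(D), (0, 0; s^2, 0))], which is wobbly. *)
Definition tends_to_wobbly (L D : divisor) (s : F) :=
  exists H0 : higgs,
    [/\ hbundle H0 = dsum (L - D) (L - K + D),
        hfield H0 = s ^+ 2 *: delta_mx 1 0, is_limit H H0 & wobbly H0].

End Locus.

Definition in_Ub (g : nat) (D : divisor) :=
  [/\ effective D, forall v, coeff v D <= div_b v & deg D < g%:Z - 1].

End Torsion.
End Higgs.
End Points.

(* Main.v *)
Require Import Defs.
From mathcomp Require Import all_boot all_order all_algebra.
From mathcomp Require Import boolp classical_sets reals.
From mathcomp Require Import complex freeg.
From mathcomp Require Import zify ring.

Set Implicit Arguments.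
Unset Strict Implicit.
Unset Printing Implicit Defensive.

Import Order.TTheory GRing.Theory Num.Theory.
Local Open Scope ring_scope.

(** The Higgs bundle [H] sits in [M + MT] as the kernel of a functional to
    [O_div(b)], where [Phi] is congruent to the scalar [a].  At a point of [div b]
    the functional is a non-zero covector, and [div b] is reduced because the
    spectral curve is nodal ([div_b_le1]); so the intersection of [H] with a
    summand [S] of [M + MT] is [S(-D)], with [D] the set of points where the
    functional does not kill [S] ([defect_saturated]), and the image of [H] in the
    other summand [S'] is [S'(-div b + D)] ([defect_quotient]).  When
    [deg D < g - 1], the subbundle [S(-D)] has positive degree, and it is maximal
    destabilizing because line subbundles along two different directions have total
    degree at most [deg H = 0].

    If [H] is a semistable bundle, the family [(H, t phi)] itself extends to
    [t = 0] by [(H, 0)].  An off-diagonal corner of [Phi] is a nilpotent field on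
    [M + MT], and since [b] vanishes on [div b] it preserves [H]
    ([nilpotent_higgs_ex]): [H] is wobbly.  If [S(-D)] destabilizes [H], rescaling
    along it degenerates [H] to its graded object.  The quotient is
    [S K^-1 (D)] through division by the off-diagonal entry of [Phi], and the
    component [S(-D) -> S K^-1 (D) K] of the field vanishes exactly on [2 D]
    ([directions_degenerate]).

    It remains to decide when [L0 + L1], with a field [gamma : L0 -> L1 K] and
    [deg L0 = - deg L1 > 0], is very stable.  If [gamma] has a multiple zero, the
    lattice can be sheared there by a function with a simple pole; the new bundle,
    with the same nilpotent field, flows to [L0 + L1] and is not isomorphic to it
    ([wobbly11]).  If [gamma] has no zero, let [H] be nilpotent and flow to
    [L0 + L1].  The leading coefficient of the degeneration is a non-zero map
    [L0 + L1 -> H] that kills the image of the field ([degeneration_map]), hence a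
    map [u] from [L0] to [H].  Semistability makes [phi u] independent of [u], so
    that [(u, phi u)] is an injection of [L0 + L1] in [H] between bundles of the same
    degree, an isomorphism of Higgs bundles ([very_stable11]).

    All these comparisons of degrees come from one fact on function fields: a line
    bundle of negative degree has no non-zero section ([deg_le0]).  For a
    non-constant [f], functions that separate the zeros of [f] are independent over
    [C[f]] ([zeros_independent]), and a dimension count bounds the number of
    independent functions by the number of poles ([independent_le_poles]).  The
    count needs functions without poles to be constant, that is, enough discrete
    valuations: they come from maximal subrings avoiding a given function
    ([exists_pole]). *)

(** * Algebraic dependence over the constants *)

Section LinearAlgebra.

Lemma exists_linear_relation (C : fieldType) (I J : finType) (A : I -> J -> C) :
  (#|J| < #|I|)%N ->
  exists c : I -> C, (exists i, c i != 0) /\ forall j, \sum_i c i * A i j = 0.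
Proof.
move=> ltJI; pose B := \matrix_(i < #|I|, j < #|J|) A (enum_val i) (enum_val j).
have kerB : kermx B != 0.
  rewrite -mxrank_eq0 mxrank_ker -lt0n subn_gt0.
  exact: leq_ltn_trans (rank_leq_col B) ltJI.
have /rowV0Pn[w /sub_kermxP wB w0] := kerB.
exists (fun i => w 0 (enum_rank i)); split.
  have /rV0Pn[k wk] := w0.
  by exists (enum_val k); rewrite enum_valK.
move=> j; have /rowP/(_ (enum_rank j)) := wB; rewrite !mxE => wBj; rewrite -[RHS]wBj.
rewrite [RHS](reindex (@enum_rank I)) /=; last exact/onW_bij/enum_rank_bij.
by apply: eq_bigr => i _; rewrite mxE !enum_rankK.
Qed.

End LinearAlgebra.

Section FunctionField.
Context (R : realType) (X : curve R).
Local Notation C := R[i].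
Local Notation F := (fun_field X).
Local Notation iota := (const X).
Local Notation point := (Defs.point X).
Implicit Types (f h x y z : F) (v w : point) (p q : {poly C}).

Definition peval x p : F := (map_poly iota p).[x].
Local Notation "p $ x" := (peval x p) (at level 8, x at level 8).

Lemma pevalD x : {morph peval x : p q / p + q}.
Proof. by move=> p q; rewrite /peval rmorphD hornerD. Qed.
Lemma pevalM x : {morph peval x : p q / p * q}.
Proof. by move=> p q; rewrite /peval rmorphM hornerM. Qed.
Lemma pevalC x c : peval x c%:P = iota c.
Proof. by rewrite /peval map_polyC hornerC. Qed.
Lemma pevalX x : peval x 'X = x.
Proof. by rewrite /peval map_polyX hornerX. Qed.
Lemma peval1 x : peval x 1 = 1.
Proof. by rewrite -polyC1 pevalC rmorph1. Qed.
Lemma peval0 x : peval x 0 = 0.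
Proof. by rewrite -polyC0 pevalC rmorph0. Qed.
Lemma pevalXn x p n : peval x (p ^+ n) = peval x p ^+ n.
Proof. by rewrite /peval rmorphXn horner_exp. Qed.
Lemma peval_sum x I (r : seq I) (P : pred I) (q : I -> {poly C}) :
  peval x (\sum_(i <- r | P i) q i) = \sum_(i <- r | P i) peval x (q i).
Proof. by rewrite /peval rmorph_sum horner_sum. Qed.

Lemma pevalE x p d : (size p <= d)%N ->
  peval x p = \sum_(i < d) iota p`_i * x ^+ i.
Proof.
move=> sp; rewrite /peval (horner_coef_wide _ (_ : size _ <= d)%N); last first.
  by rewrite size_map_poly.
by apply: eq_bigr => i _; rewrite coef_map.
Qed.

Definition nonconstant f := forall z : C, f != iota z.

Lemma nonconstantPn f : ~ nonconstant f -> exists z : C, f = iota z.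
Proof.
by move=> nf; apply: contrapT => h; apply: nf => z; apply/eqP => fz; apply: h; exists z.
Qed.

Lemma nonconstant_neq0 f : nonconstant f -> f != 0.
Proof. by move/(_ 0); rewrite rmorph0. Qed.

Lemma nonconstantV f : nonconstant f -> nonconstant f^-1.
Proof.
by move=> nf z; apply: contraNneq (nf z^-1) => e; rewrite fmorphV -e invrK.
Qed.

Lemma nonconstant_transcendental f p : nonconstant f -> p != 0 -> p$f != 0.
Proof.
move=> nf p0; have [r ->] := closed_field_poly_normal p.
rewrite -mul_polyC pevalM pevalC mulf_neq0 ?fmorph_eq0 ?lead_coef_eq0 //.
elim: r => [|z r IH]; first by rewrite big_nil peval1 oner_neq0.
rewrite big_cons pevalM mulf_neq0 // pevalD pevalX -polyCN pevalC rmorphN.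
by rewrite subr_eq0.
Qed.

(** Multiplication by [x] has degree [d] on the [C[x0]]-lattice spanned by the
    [e i], so the products [x^i z_j] with [i < k] lie in a space of dimension
    [n d k + O(1)], while there are [N k] of them: [N = n d + 1] suffices. *)
Lemma bounded_transcendence x : exists N, forall z : 'I_N -> F,
  exists p : 'I_N -> {poly C}, (exists j, p j != 0) /\ \sum_j (p j)$x * z j = 0.
Proof.
have [x0 [x0_tr [n [e gen]]]] := curve_axiom X.
pose lat (Q : {poly C}) d f := exists p : 'I_n -> {poly C},
  (forall i, (size (p i) <= d)%N) /\ Q$x0 * f = \sum_i (p i)$x0 * e i.
have latD Q d d' f : (d <= d')%N -> lat Q d f -> lat Q d' f.
  by move=> dd [p [sp E]]; exists p; split=> // i; exact: leq_trans (sp i) dd.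
have latM Q d q d' f : (size q <= d')%N -> lat Q d f -> lat (q * Q) (d' + d)%N f.
  move=> sq [p [sp E]]; exists (fun i => q * p i); split=> [i|].
    apply: leq_trans (size_polyMleq _ _) _; apply: leq_trans (leq_pred _) _.
    exact: leq_add.
  by rewrite pevalM -mulrA E mulr_sumr; apply: eq_bigr => i _; rewrite pevalM mulrA.
have lat_ex f : exists Q d, Q != 0 /\ lat Q d f.
  have [Q [p [Q0 E]]] := gen f; exists Q, (\max_i size (p i)); split=> //.
  by exists p; split=> // i; exact: leq_bigmax.
have lat_fam m (z : 'I_m -> F) : exists Q d, Q != 0 /\ forall i, lat Q d (z i).
  elim: m z => [|m IH] z; first by exists 1, 0%N; rewrite oner_neq0; split=> // -[].
  have [Q [d [Q0 H]]] := IH (fun i => z (fintype.lift ord0 i)).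
  have [q [d' [q0 H']]] := lat_ex (z ord0).
  exists (q * Q), (size q + size Q + d + d')%N; split; first by rewrite mulf_neq0.
  move=> i; case: (unliftP ord0 i) => [j ->|->].
    by apply: latD (latM _ _ _ _ _ (leqnn (size q)) (H j)); lia.
  by rewrite mulrC; apply: latD (latM _ _ _ _ _ (leqnn (size Q)) H'); lia.
have [q [d0 [q0 Hq]]] := lat_fam n (fun i => x * e i).
pose d := (d0 + size q)%N.
have {Hq}Hq i : lat q d (x * e i) by apply: latD (Hq i); lia.
have /choice[A HA] : forall i, exists p : 'I_n -> {poly C},
  (forall l, (size (p l) <= d)%N) /\ q$x0 * (x * e i) = \sum_l (p l)$x0 * e l.
  exact: Hq.
have latX Q d' f : lat Q d' f -> lat (q * Q) (d + d')%N (x * f).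
  move=> [p [sp E]]; exists (fun l => \sum_i p i * A i l); split=> [l|].
    apply: leq_trans (size_sum _ _ _) _; apply/bigmax_leqP => i _.
    apply: leq_trans (size_polyMleq _ _) _; apply: leq_trans (leq_pred _) _.
    by rewrite addnC leq_add // (HA i).1.
  transitivity (\sum_i (p i)$x0 * (q$x0 * (x * e i))).
    rewrite pevalM (_ : _ * _ = q$x0 * x * (Q$x0 * f)); last by ring.
    by rewrite E mulr_sumr; apply: eq_bigr => i _; ring.
  under eq_bigr do rewrite (HA _).2 mulr_sumr.
  rewrite exchange_big; apply: eq_bigr => l _; rewrite peval_sum mulr_suml.
  by apply: eq_bigr => i _; rewrite pevalM mulrA.
have latXk Q d' f k i : (i <= k)%N -> lat Q d' f -> lat (q ^+ k * Q) (d * k + d')%N (x ^+ i * f).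
  move=> + H; elim: k i => [|k IH] i.
    rewrite leqn0 => /eqP->; rewrite !expr0 !mul1r. by apply: latD H; rewrite leq_addl.
  case: i => [_|i lei].
    rewrite exprS -mulrA mulnS -addnA; apply: (latM) => //; first by rewrite /d; lia.
    exact: IH.
  by rewrite !exprS -!mulrA mulnS -addnA; apply: latX; exact: IH.
exists (n * d).+1 => z.
have [Q [D [Q0 Hz]]] := lat_fam _ z.
pose k := (n * D)%N.
have /choice[P HP] : forall ij : 'I_k.+1 * 'I_(n * d).+1, exists p : 'I_n -> {poly C},
  (forall l, (size (p l) <= d * k + D)%N) /\
  (q ^+ k * Q)$x0 * (x ^+ ij.1 * z ij.2) = \sum_l (p l)$x0 * e l.
  by case=> i j; apply: latXk => //; rewrite -ltnS.
have [|c [[[i0 j0] ci0] Hc]] := exists_linear_relation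
  (I := ('I_k.+1 * 'I_(n * d).+1)%type) (J := ('I_n * 'I_(d * k + D))%type)
  (fun ij lm => (P ij lm.1)`_lm.2).
  rewrite !card_prod !card_ord /k; nia.
exists (fun j => \poly_(i < k.+1) c (inord i, j)); split.
  exists j0; apply/eqP => /polyP/(_ i0).
  by rewrite coef_poly ltn_ord inord_val coef0 => /eqP; rewrite (negPf ci0).
have qQ0 : (q ^+ k * Q)$x0 != 0 by rewrite x0_tr // mulf_neq0 ?expf_neq0.
apply: (mulfI qQ0); rewrite mulr0.
transitivity (\sum_ij iota (c ij) * ((q ^+ k * Q)$x0 * (x ^+ ij.1 * z ij.2))).
  transitivity (\sum_i \sum_j iota (c (i, j)) *
    ((q ^+ k * Q)$x0 * (x ^+ i * z j))); last first.
    by rewrite pair_bigA; apply: eq_bigr => -[].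
  rewrite exchange_big mulr_sumr /=; apply: eq_bigr => j _.
  rewrite (@pevalE x _ k.+1) ?size_poly // mulr_suml mulr_sumr.
  by apply: eq_bigr => i _; rewrite coef_poly ltn_ord inord_val; ring.
under eq_bigr do rewrite (HP _).2 mulr_sumr.
rewrite exchange_big big1 // => l _ /=.
have sP ij : (size (P ij l) <= d * k + D)%N := (HP ij).1 l.
under eq_bigr => ij _ do rewrite (pevalE x0 (sP ij)) mulrA mulr_sumr mulr_suml.
rewrite exchange_big big1 // => m _ /=.
under eq_bigr => ij _ do rewrite mulrA -rmorphM -mulrA.
by rewrite -mulr_suml -rmorph_sum (Hc (l, m)) rmorph0 mul0r.
Qed.

(** A power of [x] dividing all the coefficients cancels; what remains can be
    reduced modulo [x] at a valuation that is positive on [x]. *)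
Lemma normalized_relation x N (z : 'I_N -> F) (p : 'I_N -> {poly C}) :
  x != 0 -> (exists j, p j != 0) -> \sum_j (p j)$x * z j = 0 ->
  exists p' : 'I_N -> {poly C}, (exists j, (p' j)`_0 != 0) /\ \sum_j (p' j)$x * z j = 0.
Proof.
move=> x0 [j]; have [n] := ubnP (size (p j)); elim: n => // n IH in p *.
move=> sp pj0 E.
have [[j' h]|h] := pselect (exists j, (p j)`_0 != 0); first by exists p; split=> //; exists j'.
have pE i : p i = (p i %/ 'X) * 'X.
  rewrite divpK // -(subr0 'X) -polyC0 dvdp_XsubCl rootE horner_coef0.
  by apply: contrapT => /negP hi; apply: h; exists i.
apply: (IH (fun i => p i %/ 'X)).
- by move: sp; rewrite [in X in (X < _)%N -> _]pE size_mulX ?ltnS //;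
  apply: contraNneq pj0 => e; rewrite pE e mul0r.
- by apply: contraNneq pj0 => e; rewrite pE e mul0r.
apply: (mulIf x0); rewrite mulr_suml mul0r -[RHS]E; apply: eq_bigr => i _.
by rewrite [in RHS]pE pevalM pevalX; ring.
Qed.

Lemma bounded_independence x : nonconstant x -> exists N, forall z : 'I_N -> F,
  exists p : 'I_N -> {poly C},
    (exists j, (p j)`_0 != 0) /\ \sum_j (p j)$x * z j = 0.
Proof.
move=> nx; have [N HN] := bounded_transcendence x; exists N => z.
have [p [p0 E]] := HN z.
exact: normalized_relation (nonconstant_neq0 nx) p0 E.
Qed.

End FunctionField.

(** * Valuations and approximation *)

Section Valuations.
Context (R : realType) (X : curve R).
Local Notation C := R[i].
Local Notation F := (fun_field X).
Local Notation iota := (const X).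
Local Notation point := (Defs.point X).
Implicit Types (f h x y z : F) (v w : point) (n m : int).

Lemma ord_one v : ord v 1 = 0.
Proof. by rewrite -(rmorph1 iota) ord_const. Qed.

Lemma ordN1 v : ord v (-1) = 0.
Proof. by rewrite -(rmorphN1 iota) ord_const. Qed.

Lemma ordN v f : ord v (- f) = ord v f.
Proof.
have [->|f0] := eqVneq f 0; first by rewrite oppr0.
by rewrite -mulN1r ordM ?ordN1 ?add0r // oppr_eq0 oner_eq0.
Qed.

Lemma ordV v f : ord v f^-1 = - ord v f.
Proof.
have [->|f0] := eqVneq f 0; first by rewrite invr0 Defs.ord0 oppr0.
by apply/eqP; rewrite -addr_eq0 -ordM ?invr_eq0 // mulVf // ord_one.
Qed.

Lemma ordXn v f (k : nat) : ord v (f ^+ k) = k%:Z * ord v f.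
Proof.
have [->|f0] := eqVneq f 0.
  by rewrite expr0n; case: k => [|k]; rewrite ?ord_one Defs.ord0 mulr0.
elim: k => [|k IH]; first by rewrite expr0 ord_one mul0r.
by rewrite exprS ordM ?expf_neq0 // IH; lia.
Qed.

Lemma ordXz v f m : ord v (f ^ m) = m * ord v f.
Proof. by case: m => k; rewrite ?ordV ordXn //; lia. Qed.

Lemma ord_uniformizer v : ord v (uniformizer v) = 1.
Proof. by rewrite /uniformizer; case: cid. Qed.

Lemma ord_geN0 v n f : f != 0 -> ord_ge v n f -> n <= ord v f.
Proof. by move=> /eqP f0 []. Qed.

Lemma ord_geP v n f : f != 0 -> ord_ge v n f <-> n <= ord v f.
Proof. by move=> f0; split; [exact: ord_geN0 | right]. Qed.

Lemma ord_ge_iota v (c : C) : ord_ge v 0 (iota c).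
Proof. by right; rewrite ord_const. Qed.

Lemma ord_geW v n m f : m <= n -> ord_ge v n f -> ord_ge v m f.
Proof. by move=> mn [->|h]; [left | right; exact: le_trans mn h]. Qed.

Lemma ord_geD v n f h : ord_ge v n f -> ord_ge v n h -> ord_ge v n (f + h).
Proof.
have [->|f0] := eqVneq f 0; first by rewrite add0r.
have [->|h0] := eqVneq h 0; first by rewrite addr0.
move=> /(ord_geN0 f0) hf /(ord_geN0 h0) hh.
have [->|fh0] := eqVneq (f + h) 0; first by left.
by right; apply: le_trans (ordD v f0 h0 fh0); rewrite le_min hf.
Qed.

Lemma ord_geN v n f : ord_ge v n f -> ord_ge v n (- f).
Proof. by case=> [->|h]; [left; rewrite oppr0 | right; rewrite ordN]. Qed.

Lemma ord_geB v n f h : ord_ge v n f -> ord_ge v n h -> ord_ge v n (f - h).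
Proof. by move=> hf hh; apply: ord_geD => //; exact: ord_geN. Qed.

Lemma ord_geM v n m f h : ord_ge v n f -> ord_ge v m h -> ord_ge v (n + m) (f * h).
Proof.
case=> [->|hf]; first by left; rewrite mul0r.
case=> [->|hh]; first by left; rewrite mulr0.
have [->|f0] := eqVneq f 0; first by left; rewrite mul0r.
have [->|h0] := eqVneq h 0; first by left; rewrite mulr0.
by right; rewrite ordM // lerD.
Qed.

Lemma ord_geM' v k n m f h : ord_ge v n f -> ord_ge v m h -> k <= n + m ->
  ord_ge v k (f * h).
Proof. by move=> hf hh le; apply: ord_geW le _; exact: ord_geM. Qed.

Lemma ord_ge_sum v n (I : Type) (r : seq I) (P : pred I) (z : I -> F) :
  (forall i, P i -> ord_ge v n (z i)) -> ord_ge v n (\sum_(i <- r | P i) z i).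
Proof.
by move=> H; apply: (big_ind (ord_ge v n)) => //; [left | move=> *; exact: ord_geD].
Qed.

Lemma ord_geXn v f (k : nat) : ord_ge v 0 f -> ord_ge v 0 (f ^+ k).
Proof.
move=> H; elim: k => [|k IH]; first by right; rewrite expr0 ord_one.
by rewrite exprS -[0]addr0; exact: ord_geM.
Qed.

Lemma ord_eq_add v f h : f != 0 -> ord_ge v (ord v f + 1) h ->
  f + h != 0 /\ ord v (f + h) = ord v f.
Proof.
move=> f0 [->|]; first by rewrite addr0.
have [->|h0 lt] := eqVneq h 0; first by rewrite addr0.
have fh0 : f + h != 0.
  by apply/eqP => /eqP; rewrite addr_eq0 => /eqP E; move: lt; rewrite E ordN; lia.
split=> //; apply/eqP; rewrite eq_le; apply/andP; split; last first.
  by apply: le_trans (ordD v f0 h0 fh0); rewrite le_min lexx; lia.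
have /(ordD v fh0) : - h != 0 by rewrite oppr_eq0.
rewrite addrK f0 ordN => /(_ isT); rewrite ge_min => /orP[//|]; lia.
Qed.

Lemma dominated_sum_neq0 v (I : finType) (z : I -> F) (i0 : I) : z i0 != 0 ->
  (forall i, i != i0 -> ord_ge v (ord v (z i0) + 1) (z i)) -> \sum_i z i != 0.
Proof.
move=> z0 H; rewrite (bigD1 i0) //=.
have [|//] := @ord_eq_add v _ (\sum_(i | i != i0) z i) z0.
exact: ord_ge_sum.
Qed.

Lemma ord_ge_peval v f (p : {poly C}) : ord_ge v 0 f -> ord_ge v 0 (peval f p).
Proof.
move=> H; rewrite (pevalE _ (leqnn _)); apply: ord_ge_sum => i _.
by rewrite -[0]addr0; apply: ord_geM; [exact: ord_ge_iota | exact: ord_geXn].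
Qed.

Lemma ord_peval_unit v f (p : {poly C}) : ord_ge v 1 f -> p`_0 != 0 ->
  peval f p != 0 /\ ord v (peval f p) = 0.
Proof.
move=> H; elim/poly_ind: p => [|q c _]; first by rewrite coef0 eqxx.
rewrite coefD coefMX coefC /= add0r => c0.
rewrite pevalD pevalM pevalX pevalC addrC.
have ic0 : iota c != 0 by rewrite fmorph_eq0.
have [|//] := @ord_eq_add v _ (peval f q * f) ic0; last by rewrite ord_const.
rewrite ord_const; apply: (ord_geM' (ord_ge_peval _ _) H) => //.
exact: ord_geW H.
Qed.

(** The residue field is [C]: were the residue of [f] transcendental, the powers
    of a uniformizer would be independent over [C[f]]. *)
Lemma residue v f : ord_ge v 0 f -> exists l : C, ord_ge v 1 (f - iota l).
Proof.
move=> hf; apply: contrapT => no.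
have fl (l : C) : f - iota l != 0 /\ ord v (f - iota l) = 0.
  have fl0 : f - iota l != 0.
    by apply/eqP => e; apply: no; exists l; rewrite e; left.
  split=> //; apply/eqP; rewrite eq_le.
  have /(ord_geN0 fl0) -> : ord_ge v 0 (f - iota l).
    by apply: ord_geB => //; exact: ord_ge_iota.
  rewrite andbT leNgt; apply/negP => h; apply: no; exists l; right; lia.
have nf : nonconstant f by move=> l; rewrite -subr_eq0 (fl l).1.
have pf (p : {poly C}) : p != 0 -> ord v (peval f p) = 0.
  move=> p0; have [r ->] := closed_field_poly_normal p.
  have lc0 : lead_coef p != 0 by rewrite lead_coef_eq0.
  rewrite -mul_polyC pevalM pevalC.
  have [] : peval f (\prod_(z <- r) ('X - z%:P)) != 0 /\
            ord v (peval f (\prod_(z <- r) ('X - z%:P))) = 0.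
    elim: r => [|z r [IH0 IH]]; first by rewrite big_nil peval1 oner_neq0 ord_one.
    rewrite big_cons pevalM pevalD pevalX -polyCN pevalC rmorphN.
    by rewrite mulf_neq0 ?(fl z).1 // ordM ?(fl z).1 // (fl z).2 IH.
  by move=> P0 oP; rewrite ordM ?fmorph_eq0 // ord_const oP.
have [N /(_ (fun j => uniformizer v ^+ j))[p [[j0 pj0] E]]] := bounded_transcendence f.
have [j1 pj1 minj] : exists2 j1, p j1 != 0 & forall j, p j != 0 -> (j1 <= j)%N.
  by case: (@arg_minnP _ j0 (fun j => p j != 0) (@nat_of_ord N) pj0) => j ? ?; exists j.
have ot (j : nat) : ord v (uniformizer v ^+ j) = j.
  by rewrite ordXn ord_uniformizer mulr1.
have ord_term j : p j != 0 -> ord v (peval f (p j) * uniformizer v ^+ j) = j :> int.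
  move=> pj; rewrite ordM ?expf_neq0 ?uniformizer_neq0 ?nonconstant_transcendental //.
  by rewrite pf // ot add0r.
suff : \sum_j peval f (p j) * uniformizer v ^+ j != 0 by rewrite E eqxx.
apply: (@dominated_sum_neq0 v _ _ j1).
  by rewrite mulf_neq0 ?expf_neq0 ?uniformizer_neq0 ?nonconstant_transcendental.
move=> j jj1; have [->|pj] := eqVneq (p j) 0; first by left; rewrite peval0 mul0r.
right; rewrite !ord_term //; have := minj j pj; rewrite leq_eqVlt eq_sym.
by rewrite (inj_eq val_inj) (negPf jj1) /=; lia.
Qed.

Lemma point_eq v w : (forall f, ord v f = ord w f) -> v = w.
Proof.
case: v w => [o a b c d e] [o' a' b' c' d' e'] /= H.
have oo' : o = o' by apply/funext.
by subst o'; congr Point; exact: Prop_irrelevance.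
Qed.

(** A discrete valuation ring is a maximal subring. *)
Lemma valuation_ring_inj v w : (forall f, 0 <= ord v f -> 0 <= ord w f) -> v = w.
Proof.
move=> H; have t0 := uniformizer_neq0 v.
have ounit f : f != 0 -> ord v f = 0 -> ord w f = 0.
  move=> f0 of0; apply/eqP; rewrite eq_le H ?of0 // andbT.
  by rewrite -oppr_ge0 -ordV H // ordV of0.
set e := ord w (uniformizer v).
have e_ge0 : 0 <= e by apply: H; rewrite ord_uniformizer.
have oe f : f != 0 -> ord w f = ord v f * e.
  move=> f0; have tk0 : uniformizer v ^ (- ord v f) != 0 by rewrite expfz_neq0.
  have : ord w (f * uniformizer v ^ (- ord v f)) = 0.
    by rewrite ounit ?mulf_neq0 // ordM // ordXz ord_uniformizer; lia.
  by rewrite ordM // ordXz -/e; lia.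
have [f fE] := ord_surj w.
have f0 : f != 0 by apply: contra_eq_neq fE => ->; rewrite Defs.ord0.
have e1 : e = 1.
  move: fE; rewrite oe //; have [le0|ge1] := lerP (ord v f) 0; nia.
apply: point_eq => h; have [->|h0] := eqVneq h 0; first by rewrite !Defs.ord0.
by rewrite oe // e1 mulr1.
Qed.

(** Each ring contains an element outside the other; take their quotient. *)
Lemma separate v w : v != w -> exists x, ord v x > 0 /\ ord w x < 0.
Proof.
move=> vw.
have sep v1 w1 : v1 != w1 -> exists a, 0 <= ord v1 a /\ ord w1 a < 0.
  move=> ne; apply: contrapT => no; move/eqP: ne; apply; apply: valuation_ring_inj => f vf.
  by rewrite leNgt; apply/negP => wf; apply: no; exists f.
have [a [va wa]] := sep _ _ vw.
have [|b [wb vb]] := sep w v; first by rewrite eq_sym.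
have a0 : a != 0 by apply: contraTneq wa => ->; rewrite Defs.ord0.
have b0 : b != 0 by apply: contraTneq vb => ->; rewrite Defs.ord0.
by exists (a / b); rewrite !ordM ?invr_eq0 // !ordV; lia.
Qed.

Lemma separate_seq v (s : seq point) : v \notin s ->
  exists x, ord v x > 0 /\ forall w, w \in s -> ord w x < 0.
Proof.
elim: s => [_|w s IH]; first by exists (uniformizer v); rewrite ord_uniformizer.
rewrite inE negb_or => /andP[vw /IH[y [vy sy]]].
have [z [vz wz]] := separate vw.
have y0 : y != 0 by apply: contraTneq vy => ->; rewrite Defs.ord0.
have z0 : z != 0 by apply: contraTneq vz => ->; rewrite Defs.ord0.
(* For large r, no cancellation occurs in y + z ^ r at the points of w :: s. *)
have [r r0 Hr] : exists2 r : nat, (0 < r)%N & forall u, u \in w :: s ->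
    (ord u y < 0) || (ord u z < 0) -> r%:Z * ord u z != ord u y.
  exists (\max_(u <- w :: s) `|ord u y|%N).+1 => // u us.
  have : (`|ord u y| <= \max_(u <- w :: s) `|ord u y|)%N by exact: leq_bigmax_seq.
  by move=> le /orP[] lt0; apply/eqP => e; have [o0|o0] := eqVneq (ord u z) 0; nia.
have zr0 : z ^+ r != 0 by rewrite expf_neq0.
have ord_min u : ord u y != ord u (z ^+ r) -> y + z ^+ r != 0 /\
    ord u (y + z ^+ r) = Num.min (ord u y) (ord u (z ^+ r)).
  case: ltgtP => // [lt|gt] _.
    by apply: ord_eq_add => //; right; lia.
  by rewrite addrC; apply: ord_eq_add => //; right; lia.
exists (y + z ^+ r); split.
  have [E|ne] := eqVneq (y + z ^+ r) 0; last first.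
    apply: lt_le_trans (ordD v y0 zr0 ne); rewrite lt_min vy ordXn; nia.
  have [] := ord_min w; last by rewrite E eqxx.
  by rewrite ordXn eq_sym Hr ?mem_head ?wz ?orbT.
move=> u us; have [] := ord_min u; first rewrite ordXn eq_sym Hr //.
  by move: us; rewrite inE => /orP[/eqP->|/sy->]; rewrite ?wz ?orbT.
move=> _ ->; rewrite gt_min ordXn; move: us; rewrite inE => /orP[/eqP->|us].
  by apply/orP; right; nia.
by rewrite sy.
Qed.

(** If [x] vanishes at [v] and has poles on [s], then [1 / (1 + x)] is a unit at [v]
    and vanishes on [s]; a power of it vanishes there to any order. *)
Lemma approximate_indicator v (s : seq point) (n : nat) : v \notin s ->
  exists e, [/\ e != 0, ord v e = 0 & forall w, w \in s -> n%:Z <= ord w e].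
Proof.
move=> vs; have [x [vx sx]] := separate_seq vs.
have x0 : x != 0 by apply: contraTneq vx => ->; rewrite Defs.ord0.
have [x10 vx1] : 1 + x != 0 /\ ord v (1 + x) = ord v 1.
  by apply: ord_eq_add; [exact: oner_neq0 | rewrite ord_one; right].
exists ((1 + x)^-1 ^+ n); split; first by rewrite expf_neq0 ?invr_eq0.
  by rewrite ordXn ordV vx1 ord_one; lia.
move=> w /sx wx; have [_ wx1] : x + 1 != 0 /\ ord w (x + 1) = ord w x.
  by apply: ord_eq_add => //; right; rewrite ord_one; lia.
by rewrite ordXn ordV addrC wx1; nia.
Qed.

End Valuations.

(** * Existence of poles *)

Section ExistenceOfPoles.
Context (R : realType) (X : curve R).
Local Notation C := R[i].
Local Notation F := (fun_field X).
Local Notation iota := (const X).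
Local Notation point := (Defs.point X).
Implicit Types (f h x y z t : F).

Definition subalgebra (A : set F) :=
  [/\ forall c, A (iota c), forall a b, A a -> A b -> A (a + b)
    & forall a b, A a -> A b -> A (a * b)].

(** As in the extension theorem for places, such a ring is the valuation ring of a
    place where [h] is infinite. *)
Definition maximal_avoiding h (A : set F) :=
  [/\ subalgebra A, A h^-1, ~ A h
    & forall B, subalgebra B -> (A `<=` B)%classic -> ~ B h -> (B `<=` A)%classic].

Lemma maximal_avoiding_ex h : nonconstant h -> exists A, maximal_avoiding h A.
Proof.
move=> nh; have h0 := nonconstant_neq0 nh.
pose P (A : set F) := A = set0 \/ [/\ subalgebra A, A h^-1 & ~ A h].
have [|A [[A0|[sA Ay nAh]] maxA]] := @Zorn_bigcup _ P.
- move=> G GP tot; have [[A GA [a Aa]]|no] := pselect (exists2 A, G A & exists a, A a).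
    right; have good B b : G B -> B b -> [/\ subalgebra B, B h^-1 & ~ B h].
      by move=> /GP[->|//].
    have [[Ac _ _] Ay _] := good _ _ GA Aa.
    split; [split|by exists A|].
    + by move=> c; exists A.
    + move=> b c [B GB Bb] [D GD Dc]; have [[_ BD _] _ _] := good _ _ GB Bb.
      have [[_ DD _] _ _] := good _ _ GD Dc.
      have [sBD|sDB] := tot _ _ GB GD; first by exists D => //; apply: DD => //; exact: sBD.
      by exists B => //; apply: BD => //; exact: sDB.
    + move=> b c [B GB Bb] [D GD Dc]; have [[_ _ BM] _ _] := good _ _ GB Bb.
      have [[_ _ DM] _ _] := good _ _ GD Dc.
      have [sBD|sDB] := tot _ _ GB GD; first by exists D => //; apply: DM => //; exact: sBD.
      by exists B => //; apply: BM => //; exact: sDB.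
    + by move=> [B GB Bh]; have [_ _] := good _ _ GB Bh; exact.
  by left; apply/seteqP; split=> // b [B GB Bb]; apply: no; exists B => //; exists b.
- pose B : set F := fun f => exists p, f = peval h^-1 p.
  have PB : P B.
    right; split; [split|exists 'X; by rewrite pevalX|].
    + by move=> c; exists c%:P; rewrite pevalC.
    + by move=> a b [p ->] [q ->]; exists (p + q); rewrite pevalD.
    + by move=> a b [p ->] [q ->]; exists (p * q); rewrite pevalM.
    move=> [p hp]; have Xp0 : 'X * p - 1 != 0.
      apply/eqP => /polyP/(_ 0%N)/eqP.
      by rewrite coefB coefXM coef1 coef0 sub0r oppr_eq0 oner_eq0.
    have /eqP := nonconstant_transcendental (nonconstantV nh) Xp0; apply.
    by rewrite pevalD pevalM pevalX -hp -polyCN pevalC rmorphN1 mulVf // subrr.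
  exfalso; apply: (maxA B) => //; rewrite A0; split=> // sB0.
  by apply: (sB0 (iota 0)); exists 0; rewrite peval0 rmorph0.
exists A; split=> // B sB sAB nBh; apply: contrapT => nBA; apply: (maxA B).
  by split.
by right; split=> //; exact: sAB.
Qed.

Section ValuationRing.
Variables (h : F) (A : set F).
Hypotheses (nh : nonconstant h) (mA : maximal_avoiding h A).
Local Notation y := (h^-1).

Let h0 : h != 0. Proof. exact: nonconstant_neq0. Qed.
Let Ac c : A (iota c). Proof. by case: mA => -[]. Qed.
Let AD a b : A a -> A b -> A (a + b). Proof. by case: mA => -[_ H _] _ _ _; exact: H. Qed.
Let AM a b : A a -> A b -> A (a * b). Proof. by case: mA => -[_ _ H] _ _ _; exact: H. Qed.
Let Ay : A y. Proof. by case: mA. Qed.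
Let nAh : ~ A h. Proof. by case: mA. Qed.
Let A0 : A 0. Proof. by rewrite -(rmorph0 iota). Qed.
Let A1 : A 1. Proof. by rewrite -(rmorph1 iota). Qed.
Let AN a : A a -> A (- a).
Proof. by move=> Aa; rewrite -mulN1r -(rmorphN1 iota); apply: AM. Qed.
Let AX a n : A a -> A (a ^+ n).
Proof. by move=> Aa; elim: n => [|n IH]; rewrite ?expr0 // exprS; exact: AM. Qed.
Let Asum I (r : seq I) (P : pred I) (a : I -> F) :
  (forall i, P i -> A (a i)) -> A (\sum_(i <- r | P i) a i).
Proof. by move=> H; apply: big_ind. Qed.
Let Aeval x p : A x -> A (peval x p).
Proof.
by move=> Ax; rewrite (pevalE _ (leqnn _)); apply: Asum => i _; apply: AM => //; exact: AX.
Qed.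

Lemma maximal_adjoin z : ~ A z -> exists q : {poly F}, (forall i, A q`_i) /\ h = q.[z].
Proof.
move=> nAz; pose B : set F := fun f => exists q : {poly F}, (forall i, A q`_i) /\ f = q.[z].
have AB : (A `<=` B)%classic.
  by move=> a Aa; exists a%:P; rewrite hornerC; split=> // i; rewrite coefC; case: ifP.
have sB : subalgebra B.
  split; first by move=> c; apply: AB.
  - move=> a b [p [Hp ->]] [q [Hq ->]]; exists (p + q); rewrite hornerD; split=> // i.
    by rewrite coefD; exact: AD.
  - move=> a b [p [Hp ->]] [q [Hq ->]]; exists (p * q); rewrite hornerM; split=> // i.
    by rewrite coefM; apply: Asum => j _; exact: AM.
apply: contrapT => nBh; have [_ _ _ /(_ B sB AB nBh) BA] := mA.
apply: nAz; apply: BA; exists 'X; rewrite hornerX; split=> // i.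
by rewrite coefX; case: (_ == _).
Qed.

(** Let [w = 1 - y a].  If [1/w] were not in [A], then [h] would be in [A[1/w]], hence
    [w^k h] in [A] for some [k]; but [w^k = 1 - y b], so that [w^k h = h - b]. *)
Lemma maximal_unit a : A a -> 1 - y * a != 0 /\ A (1 - y * a)^-1.
Proof.
move=> Aa; have w0 : 1 - y * a != 0.
  apply/eqP => /eqP; rewrite subr_eq0 => /eqP e; apply: nAh.
  by rewrite -[h]mulr1 e mulrA mulfV // mul1r.
split=> //; apply: contrapT => /maximal_adjoin[q [Aq hq]].
set w := 1 - y * a in w0 hq.
have Aw : A w by apply: AD => //; apply: AN; exact: AM.
have Awh : A (w ^+ size q * h).
  rewrite hq horner_coef mulr_sumr; apply: Asum => i _; rewrite mulrCA; apply: AM => //.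
  rewrite exprVn -[X in w ^+ X](subnK (ltnW (ltn_ord i))) exprD mulfK ?expf_neq0 //.
  exact: AX.
have [b [Ab wb]] : exists b, A b /\ w ^+ size q = 1 - y * b.
  elim: (size q) => [|n [b [Ab E]]]; first by exists 0; rewrite mulr0 subr0 expr0.
  exists (a + w * b); split; first by apply: AD => //; exact: AM.
  by rewrite exprS E /w; ring.
apply: nAh; rewrite [h](_ : _ = w ^+ size q * h + b); first exact: AD.
by rewrite wb; field.
Qed.

(** When [z] is not in [A], maximality puts [h] in [A[z]]; multiplying by [y] gives
    such a relation. *)
Definition unit_relation z n := exists q : {poly F},
  [/\ (size q <= n)%N, forall i, exists a, A a /\ q`_i = y * a & q.[z] = 1].

(** The constant term of the relation for [1/z] is of the form [y a], so that one can
    solve for [1] and multiply by [z^n]: this expresses [z^n] by smaller powers of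
    [z], and removes the leading term of the relation for [z]. *)
Lemma unit_relation_reduce z n m : z != 0 -> (m <= n)%N ->
  unit_relation z n.+1 -> unit_relation z^-1 m.+1 -> unit_relation z n.
Proof.
move=> z0 mn [q [sq Iq q1]] [q' [sq' Iq' q'1]].
have [a0 [Aa0 d0]] := Iq' 0%N; have [u0 Au] := maximal_unit Aa0.
rewrite -d0 in u0 Au.
exists (\poly_(i < n) (q`_i + q`_n * (1 - q'`_0)^-1 * q'`_(n - i))); split.
- exact: size_poly.
- move=> i; rewrite coef_poly; case: ifP => _; last by exists 0; rewrite mulr0.
  have [a [Aa ->]] := Iq i; have [b [Ab ->]] := Iq n.
  have [c [Acc ->]] := Iq' (n - i)%N.
  exists (a + b * (1 - q'`_0)^-1 * (y * c)); split; last by ring.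
  by apply: AD => //; apply: AM; apply: AM.
rewrite horner_poly; under eq_bigr do rewrite mulrDl.
rewrite big_split /= -[RHS]q1 (horner_coef_wide _ sq) big_ord_recr /=; congr (_ + _).
under eq_bigr do rewrite -mulrA; rewrite -mulr_sumr -mulrA; congr (_ * _).
apply: (mulfI u0); rewrite mulVKf // mulrBl mul1r.
apply/eqP; rewrite eq_sym subr_eq -[X in X == _]mulr1 -q'1.
have sq'' : (size q' <= n.+1)%N by exact: leq_trans sq' _.
rewrite (horner_coef_wide _ sq'') mulr_sumr (reindex_inj rev_ord_inj) /=.
rewrite big_ord_recr /=. rewrite subnn expr0 mulr1 [z ^+ n * q'`_0]mulrC; apply/eqP; congr (_ + _).
apply: eq_bigr => i _; rewrite subSS mulrCA; congr (_ * _).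
by rewrite exprVn -[X in z ^+ X * _](subnKC (ltnW (ltn_ord i))) exprD mulfK ?expf_neq0.
Qed.

Lemma maximal_valuation z : z != 0 -> A z \/ A z^-1.
Proof.
have rel0 z1 : ~ unit_relation z1 0.
  by move=> [q [+ _ q1]]; rewrite leqn0 size_poly_eq0 => /eqP q0;
     move: q1; rewrite q0 horner0 => /eqP; rewrite eq_sym oner_eq0.
have noboth N : forall z1 n m, z1 != 0 -> (n + m <= N)%N ->
    unit_relation z1 n -> unit_relation z1^-1 m -> False.
  elim: N => [|N IH] z1 n m z0 + Rn Rm.
    by case: n Rn => [/rel0//|n]; rewrite addSn.
  case: n Rn => [/rel0//|n Rn]; case: m Rm => [/rel0//|m Rm] le.
  have [mn|nm] := leqP m n.
    by apply: (IH z1 n m.+1) => //; exact: unit_relation_reduce Rn Rm.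
  apply: (IH z1 n.+1 m) => //; first by lia.
  apply: (unit_relation_reduce _ (ltnW nm)) => //; first by rewrite invr_eq0.
  by rewrite invrK.
have rel z1 : ~ A z1 -> exists n, unit_relation z1 n.
  move=> /maximal_adjoin[q [Aq hq]]; exists (size q), (y *: q).
  rewrite hornerZ -hq mulVf //; split=> //; first exact: size_scale_leq.
  by move=> i; exists q`_i; rewrite coefZ.
move=> z0; apply: contrapT => /not_orP[/rel[n Rn] /rel[m Rm]].
exact: noboth z0 (leqnn _) Rn Rm.
Qed.

Definition nonunit f := f = 0 \/ ~ A f^-1.
Local Notation m := nonunit.

Let mA_A f : m f -> A f.
Proof.
by case=> [->//|nA]; have [->//|f0] := eqVneq f 0; have [] := maximal_valuation f0.
Qed.

Let mM a b : A a -> m b -> m (a * b).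
Proof.
move=> Aa [->|nb]; first by left; rewrite mulr0.
have [->|a0] := eqVneq a 0; first by left; rewrite mul0r.
have [->|b0] := eqVneq b 0; first by left; rewrite mulr0.
right=> Aab; apply: nb; rewrite (_ : b^-1 = a * (a * b)^-1); first exact: AM.
by field; rewrite a0 b0.
Qed.

Let mD a b : m a -> m b -> m (a + b).
Proof.
have [->|a0] := eqVneq a 0; first by rewrite add0r.
have [->|b0] := eqVneq b 0; first by rewrite addr0.
move=> ma mb; have ab0 : a / b != 0 by rewrite mulf_neq0 ?invr_eq0.
have [Aab|Aba] := maximal_valuation ab0.
  by rewrite (_ : a + b = (a / b + 1) * b); [apply: mM => //; exact: AD | field].
rewrite invfM invrK in Aba.
by rewrite (_ : a + b = (1 + a^-1 * b) * a); [apply: mM => //; exact: AD | field].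
Qed.

Let msum I (r : seq I) (P : pred I) (a : I -> F) :
  (forall i, P i -> m (a i)) -> m (\sum_(i <- r | P i) a i).
Proof. by move=> H; apply: big_ind => //; left. Qed.

Let m_iota c : c != 0 -> ~ m (iota c).
Proof.
move=> c0 [/eqP|]; first by rewrite fmorph_eq0 (negPf c0).
by rewrite -fmorphV.
Qed.

Let m1 : ~ m 1.
Proof. by rewrite -(rmorph1 iota); apply: m_iota; rewrite oner_eq0. Qed.

(** A strictly decreasing chain of values between that of [x] and [0] consists of
    elements independent over [C[x]]. *)
Lemma chain_bound x : x != 0 -> m x -> exists N, forall z : nat -> F,
  (forall i, (i < N)%N -> [/\ z i != 0, m (z i) & A (x / z i)]) ->
  (forall i j, (i < j < N)%N -> m (z i / z j)) -> False.
Proof.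
move=> x0 mx; have nx : nonconstant x.
  move=> c; apply/eqP => xc; have [c0|c0] := eqVneq c 0.
    by move: x0; rewrite xc c0 rmorph0 eqxx.
  by apply: (m_iota c0); rewrite -xc.
have [N HN] := bounded_independence nx; exists N => z Hz Hzz.
have [p [[j0 pj0] E]] := HN (fun j => z j).
have [j pj maxj] : exists2 j, (p j)`_0 != 0 &
    forall i, (p i)`_0 != 0 -> (i <= j)%N.
  by case: (@arg_maxnP _ j0 (fun j => (p j)`_0 != 0) (@nat_of_ord N) pj0) => i ? ?; exists i.
have [zj0 _ xzj] := Hz j (ltn_ord j).
apply: (m_iota pj).
have split0 q : exists q', peval x q = iota q`_0 + x * peval x q'.
  elim/poly_ind: q => [|q' c _]; first by exists 0; rewrite coef0 peval0 rmorph0 mulr0 addr0.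
  exists q'; rewrite coefD coefMX coefC /= add0r pevalD pevalM pevalX pevalC; ring.
have Ax := mA_A mx.
have [q' Eq'] := split0 (p j).
have -> : iota (p j)`_0 =
    - (x * peval x q' + \sum_(i | i != j) peval x (p i) * (z i / z j)).
  apply/eqP; rewrite -addr_eq0 addrA -Eq'.
  have := congr1 (fun s => s / z j) E; rewrite mul0r mulr_suml (bigD1 j) //= mulfK //.
  move=> e; rewrite -[X in _ == X]e; apply/eqP; congr (_ + _).
  by apply: eq_bigr => i _; rewrite mulrA.
rewrite -mulN1r; apply: mM; first exact: AN.
apply: mD; first by rewrite mulrC; apply: mM => //; exact: Aeval.
apply: msum => i ij; have [zi0 mzi _] := Hz i (ltn_ord i).
have [ltij|gtij|eij] := ltngtP i j.
- by apply: mM; [exact: Aeval | apply: Hzz; rewrite ltij ltn_ord].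
- have /eqP pi0 : (p i)`_0 == 0.
    by apply: contraTT gtij => /maxj; rewrite -leqNgt.
  have [q'' ->] := split0 (p i); rewrite pi0 rmorph0 add0r.
  rewrite (_ : _ * _ = peval x q'' * (x / z j) * z i); last by ring.
  by apply: mM => //; apply: AM => //; exact: Aeval.
- by move: ij; rewrite (val_inj eij) eqxx.
Qed.

Let y0 : y != 0. Proof. by rewrite invr_eq0. Qed.
Let my : m y. Proof. by right; rewrite invrK. Qed.

(** Otherwise, each element of the maximal ideal would have a successor of strictly
    smaller value, against the bound on chains below [y]. *)
Lemma maximal_generator : exists t, [/\ t != 0, m t & forall z, m z -> A (z / t)].
Proof.
apply: contrapT => no.
have /choice[G HG] : forall t, exists z, t != 0 -> m t -> m z /\ ~ A (z / t).
  move=> t; apply: contrapT => no'; have [t0 mt] : t != 0 /\ m t.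
    split; last by apply: contrapT => nt; apply: no'; exists 0 => ? /nt.
    by apply/negP => /eqP t0; apply: no'; exists 0; rewrite t0 eqxx.
  apply: no; exists t; split=> // z mz; apply: contrapT => nz.
  by apply: no'; exists z.
have [N HN] := chain_bound y0 my.
pose z i := iter i G y.
have zP i : z i != 0 /\ m (z i).
  elim: i => [//|i [zi0 mzi]]; have [mz nA] := HG _ zi0 mzi; split=> //.
  by apply/eqP => e; apply: nA; rewrite (e : G (z i) = 0) mul0r.
have zS i : m (z i / z i.+1).
  by right; rewrite invfM invrK mulrC; have [zi0 mzi] := zP i; have [] := HG _ zi0 mzi.
have zz k i : m (z i / z (i + k.+1)%N).
  elim: k => [|k IH]; first by rewrite addn1.
  rewrite (_ : _ / _ = z i / z (i + k.+1)%N * (z (i + k.+1)%N / z (i + k.+2)%N)).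
    by apply: mM; [exact: mA_A | rewrite (addnS _ k.+1)].
  by rewrite mulrA divfK // (zP _).1.
apply: (HN z) => [i _|i j /andP[ij _]].
  have [zi0 mzi] := zP i; split=> //; case: i zi0 {mzi} => [|i] zi0; first by rewrite mulfV.
  by apply: mA_A; exact: (zz i 0%N).
by rewrite -(subnKC ij) addSnnS.
Qed.

Section OrderFunction.
Variable t : F.
Hypotheses (t0 : t != 0) (mt : m t) (gent : forall z, m z -> A (z / t)).

Let mtn n : (0 < n)%N -> m (t ^+ n).
Proof. by case: n => // n _; rewrite exprSr; apply: mM => //; apply: AX; exact: mA_A. Qed.

Definition has_order f (k : int) := A (f * t ^ (- k)) /\ A (f * t ^ (- k))^-1.

(** The powers of [t] that divide [f] form a chain below [f], hence are bounded. *)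
Lemma has_order_ex f : f != 0 -> exists k, has_order f k.
Proof.
have posi f1 : f1 != 0 -> A f1 -> exists k, has_order f1 k.
  move=> f0 Af; have exk : exists k, `[< ~ A (f1 / t ^+ k) >].
    apply: contrapT => /forallNP no.
    have {no}Afk k : A (f1 / t ^+ k) by apply: contrapT => nA; apply: (no k); apply/asboolP.
    have mf : m f1.
      by rewrite -(divfK t0 f1); apply: mM => //; have := Afk 1%N; rewrite expr1.
    have [N HN] := chain_bound f0 mf; apply: (HN (fun i => t ^+ (N - i))) => [i iN|i j ijN].
      by split; [rewrite expf_neq0 | apply: mtn; lia | exact: Afk].
    rewrite (_ : (N - i = (j - i) + (N - j))%N); last lia.
    by rewrite exprD mulfK ?expf_neq0 //; apply: mtn; lia.
  case: (ex_minnP exk) => -[|n]; first by move/asboolP; rewrite expr0 divr1.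
  move=> /asboolP nAn minn {exk}.
  have An : A (f1 / t ^+ n) by apply: contrapT => /asboolP/minn; rewrite ltnn.
  exists n; rewrite /has_order -exprnN; split=> //; apply: contrapT => ni; apply: nAn.
  by rewrite exprSr invfM mulrA; apply: gent; right.
move=> f0; have [Af|Af] := maximal_valuation f0; first exact: posi.
have [|k [Ak Ak']] := posi f^-1 _ Af; first by rewrite invr_eq0.
exists (- k); rewrite /has_order opprK; split.
  by move: Ak'; rewrite invfM invrK invr_expz opprK.
by rewrite invfM invr_expz.
Qed.

Lemma has_order_unique f k l : f != 0 -> has_order f k -> has_order f l -> k = l.
Proof.
wlog le : k l / k <= l.
  by move=> W f0 hk hl; have [/W|/ltW/W e] := leP k l; [exact | symmetry; exact: e].
move=> f0 [_ hk] [hl _]; apply/eqP; rewrite eq_le le /= leNgt; apply/negP => lt.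
apply: m1; have tk0 k1 : t ^ k1 != 0 by rewrite expfz_neq0.
have -> : 1 = (f * t ^ (- l)) * (f * t ^ (- k))^-1 * t ^+ `|l - k|%N.
  have -> : t ^+ `|l - k|%N = t ^ (l - k) by rewrite -(gez0_abs (_ : 0 <= l - k)) //; lia.
  rewrite invfM invr_expz opprK expfzDr // -!invr_expz; field.
  by rewrite f0 !tk0.
by apply: mM; [exact: AM | apply: mtn; lia].
Qed.

Definition order f : int :=
  if pselect (f != 0) is left f0 then projT1 (cid (has_order_ex f0)) else 0.

Lemma orderP f : f != 0 -> has_order f (order f).
Proof. by move=> f0; rewrite /order; case: pselect => // f0'; case: cid. Qed.

Lemma orderE f k : f != 0 -> has_order f k -> order f = k.
Proof. by move=> f0; apply: has_order_unique => //; exact: orderP. Qed.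

Lemma order0 : order 0 = 0.
Proof. by rewrite /order; case: pselect => // f0; exfalso; rewrite eqxx in f0. Qed.

Lemma orderM f1 f2 : f1 != 0 -> f2 != 0 -> order (f1 * f2) = order f1 + order f2.
Proof.
move=> f10 f20; apply: orderE; first by rewrite mulf_neq0.
have [a b] := orderP f10; have [c d] := orderP f20.
by rewrite /has_order opprD expfzDr // mulrACA invfM; split; exact: AM.
Qed.

Lemma order_unit f : A f -> A f^-1 -> order f = 0.
Proof.
move=> Af Af'; have [->|f0] := eqVneq f 0; first exact: order0.
by apply: orderE => //; rewrite /has_order oppr0 expr0z mulr1.
Qed.

Lemma order_t : order t = 1.
Proof. by apply: orderE => //; rewrite /has_order -invr_expz expr1z mulfV // invr1. Qed.

Lemma order_ge0 f : f != 0 -> (0 <= order f) <-> A f.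
Proof.
move=> f0; have [a b] := orderP f0; have tk0 k1 : t ^ k1 != 0 by rewrite expfz_neq0.
have fE : f = (f * t ^ (- order f)) * t ^ (order f).
  by rewrite -mulrA -expfzDr // addNr expr0z mulr1.
have At k : 0 <= k -> A (t ^ k) by case: k => // k _; apply: AX; exact: mA_A.
split=> [/At At_|Af]; first by rewrite fE; apply: AM.
rewrite leNgt; apply/negP => lt; apply: m1.
rewrite (_ : 1 = f * (f * t ^ (- order f))^-1 * t ^+ `|order f|%N).
  by apply: mM; [exact: AM | apply: mtn; lia].
have -> : t ^+ `|order f|%N = t ^ (- order f).
  by rewrite -(gez0_abs (_ : 0 <= - order f)) ?abszN //; lia.
by field; rewrite f0 tk0.
Qed.

Lemma orderD f1 f2 : f1 != 0 -> f2 != 0 -> f1 + f2 != 0 ->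
  Num.min (order f1) (order f2) <= order (f1 + f2).
Proof.
wlog Aq : f1 f2 / A (f1 / f2).
  move=> W f10 f20 s0; have q0 : f1 / f2 != 0 by rewrite mulf_neq0 ?invr_eq0.
  have [Aq|Aq] := maximal_valuation q0; first exact: W.
  by rewrite minC addrC; apply: W => //; [move: Aq; rewrite invfM invrK mulrC | rewrite addrC].
move=> f10 f20 s0; have sE : f1 + f2 = f2 * (f1 / f2 + 1) by field.
have s10 : f1 / f2 + 1 != 0 by apply: contraNneq s0 => e; rewrite sE e mulr0.
rewrite sE orderM // ge_min; apply/orP; right; rewrite lerDl.
by apply/order_ge0 => //; exact: AD.
Qed.

Lemma order_iota c : order (iota c) = 0.
Proof. by apply: order_unit; rewrite -?fmorphV. Qed.

Definition valuation_point : point :=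
  Point order0 orderM orderD order_iota (ex_intro _ t order_t).

Lemma valuation_point_pole : ord valuation_point h < 0.
Proof. by rewrite ltNge; apply/negP => /(order_ge0 h0). Qed.

End OrderFunction.
End ValuationRing.

(** A maximal subalgebra containing [1/h] but not [h] is the valuation ring of a
    pole of [h]. *)
Lemma exists_pole h : nonconstant h -> exists v : point, ord v h < 0.
Proof.
move=> nh; have [A mA] := maximal_avoiding_ex nh.
have [t [t0 mt gent]] := maximal_generator nh mA.
by exists (valuation_point nh mA t0 mt gent); exact: valuation_point_pole.
Qed.

End ExistenceOfPoles.

(** * Zeros and poles *)

Section ProductFormula.
Context (R : realType) (X : curve R).
Local Notation C := R[i].
Local Notation F := (fun_field X).
Local Notation iota := (const X).
Local Notation point := (Defs.point X).
Implicit Types (f h w x y z t : F) (v : point) (s : seq point) (D : divisor X).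

Lemma regular_constant f : (forall v, ord_ge v 0 f) -> exists c : C, f = iota c.
Proof.
move=> reg; apply: nonconstantPn => nf; have [v vf] := exists_pole nf.
by have := ord_geN0 (nonconstant_neq0 nf) (reg v); rewrite leNgt vf.
Qed.

(** The sections of [O(D)] for an effective [D] form a space of dimension at most
    [deg D + 1]: one linear condition, the vanishing of a leading coefficient,
    lowers [D] by a point. *)
Lemma sections_dependent s (n : nat) (z : 'I_n -> F) :
  (forall i v, ord_ge v (- (count_mem v s)%:Z) (z i)) -> (size s + 1 < n)%N ->
  exists c : 'I_n -> C, (exists i, c i != 0) /\ \sum_i iota (c i) * z i = 0.
Proof.
elim: s n z => [|v s IH] n z Hz ltn.
  have /choice[a Ha] : forall i, exists a : C, z i = iota a.
    by move=> i; apply: regular_constant => v; have := Hz i v; rewrite /= oppr0.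
  have [|c [c0 Hc]] := @exists_linear_relation _ _ unit (fun (i : 'I_n) _ => a i).
    by rewrite card_unit card_ord; lia.
  exists c; split=> //; under eq_bigr do rewrite Ha -rmorphM.
  by rewrite -rmorph_sum (Hc tt) rmorph0.
case: n z Hz ltn => // n z Hz ltn.
set k := (count_mem v s).+1; pose t := uniformizer v.
have t0 : t != 0 := uniformizer_neq0 v.
have otk : ord v (t ^+ k) = k by rewrite ordXn ord_uniformizer mulr1.
have tk0 : t ^+ k != 0 by rewrite expf_neq0.
have /choice[l Hl] : forall i, exists l : C, ord_ge v 1 (t ^+ k * z i - iota l).
  move=> i; apply: residue; apply: (ord_geM' (n := k%:Z) _ (Hz i v)).
    by right; rewrite otk.
  by rewrite /= eqxx add1n subrr.
have lower (f : F) : (forall u, ord_ge u (- (count_mem u (v :: s))%:Z) f) ->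
    ord_ge v 1 (t ^+ k * f) -> forall u, ord_ge u (- (count_mem u s)%:Z) f.
  move=> Hf vf u; have := Hf u; rewrite /=; case: eqVneq => [<- _|_]; last by rewrite add0n.
  have [->|f0] := eqVneq f 0; first by left.
  right; have := ord_geN0 _ vf; rewrite mulf_neq0 // ordM // otk => /(_ isT).
  by rewrite -lerBlDl intS opprD addrA subrr add0r.
have [[i0 li0]|no] := pselect (exists i, l i != 0); last first.
  apply: IH; last by move: ltn => /=; lia.
  move=> i; apply: lower => //; have := Hl i.
  suff -> : l i = 0 by rewrite rmorph0 subr0.
  by apply/eqP; apply: contrapT => li; apply: no; exists i; apply/negP.
pose a j := l (fintype.lift i0 j) / l i0.
have [|//|c [c0 Hc]] := IH n (fun j => z (fintype.lift i0 j) - iota (a j) * z i0).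
- move=> j; apply: lower => [u|].
    apply: ord_geB => //; rewrite -[X in ord_ge _ X]add0r.
    by apply: ord_geM => //; exact: ord_ge_iota.
  rewrite (_ : _ * _ = (t ^+ k * z (fintype.lift i0 j) - iota (l (fintype.lift i0 j)))
     - iota (a j) * (t ^+ k * z i0 - iota (l i0))).
    apply: ord_geB => //; rewrite -[X in ord_ge _ X]add0r.
    by apply: ord_geM => //; exact: ord_ge_iota.
  have -> : iota (l (fintype.lift i0 j)) = iota (a j) * iota (l i0).
    by rewrite -rmorphM /a divfK.
  by ring.
exists (fun i => if unlift i0 i is Some j then c j else - \sum_j c j * a j); split.
  by have [j cj] := c0; exists (fintype.lift i0 j); rewrite liftK.
rewrite (bigD1_ord i0) //= unlift_none.
under [X in _ + X = _]eq_bigr do rewrite liftK.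
rewrite rmorphN rmorph_sum mulNr mulr_suml addrC -sumrB -[RHS]Hc.
by apply: eq_bigr => j _; rewrite rmorphM; ring.
Qed.

Lemma sections_dependent_fin s (I : finType) (z : I -> F) : (size s + 1 < #|I|)%N ->
  (forall i v, ord_ge v (- (count_mem v s)%:Z) (z i)) ->
  exists c : I -> C, (exists i, c i != 0) /\ \sum_i iota (c i) * z i = 0.
Proof.
move=> lt Hz; have [|c [[i ci] E]] := @sections_dependent s #|I| (z \o enum_val) _ lt.
  by move=> i; exact: Hz.
exists (c \o enum_rank); split; first by exists (enum_val i); rewrite /= enum_valK.
rewrite -[RHS]E [RHS](reindex (@enum_rank I)) /=; last exact/onW_bij/enum_rank_bij.
by apply: eq_bigr => j _; rewrite enum_rankK.
Qed.

(** A suitable multiple [q(f) w] is integral over [C[f]]: its poles are poles of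
    [f], of a bounded relative order. *)
Lemma integral_multiple f w : nonconstant f -> exists (q : {poly C}) (c : nat),
  q != 0 /\ forall v (k : nat), ord_ge v (- k%:Z) f ->
    ord_ge v (- (c * k)%:Z) (peval f q * w).
Proof.
move=> nf; have [w0|w0] := eqVneq w 0.
  by exists 1, 0%N; rewrite oner_neq0; split=> // v k _; left; rewrite w0 mulr0.
have [N /(_ (fun j => w ^+ j))[p [[j0 pj0] E]]] := bounded_transcendence f.
have [d pd maxd] : exists2 d : 'I_N, p d != 0 & forall j, p j != 0 -> (j <= d)%N.
  by case: (@arg_maxnP _ j0 (fun j => p j != 0) (@nat_of_ord N) pj0) => j ? ?; exists j.
have pfd := nonconstant_transcendental nf pd.
pose c := \max_(j < N) size (p j * p d ^+ (d.-1 - j)%N)%R.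
exists (p d), c; split=> // v k vf; set W := peval f (p d) * w.
have W0 : W != 0 by rewrite mulf_neq0.
right; rewrite leNgt; apply/negP => ltW.
have d_gt0 : (0 < d)%N.
  rewrite lt0n; apply/eqP => d0; move/eqP: E; apply/negP.
  rewrite (bigD1 d) //= big1 ?addr0 ?d0 ?expr0 ?mulr1 //.
  move=> j jd; have [->|/maxd] := eqVneq (p j) 0; first by rewrite peval0 mul0r.
  by rewrite d0 leqn0 => /eqP j0'; move: jd; rewrite -(inj_eq val_inj) /= j0' d0 eqxx.
have ofX (n : nat) : ord_ge v (- (n * k)%:Z) (f ^+ n).
  elim: n => [|n IH]; first by rewrite expr0; right; rewrite ord_one.
  by rewrite exprS; apply: (ord_geM' vf IH); lia.
have op (q : {poly C}) : ord_ge v (- (size q * k)%:Z) (peval f q).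
  rewrite (pevalE _ (leqnn _)); apply: ord_ge_sum => i _.
  apply: (ord_geM' (ord_ge_iota _ _) (ofX i)); have := ltn_ord i; nia.
have : \sum_(j < N) peval f (p j) * w ^+ j * peval f (p d) ^+ d.-1 != 0.
  have Ed : peval f (p d) * w ^+ d * peval f (p d) ^+ d.-1 = W ^+ d.
    by rewrite /W exprMn -[X in _ = _ ^+ X * _](prednK d_gt0) exprS; ring.
  apply: (@dominated_sum_neq0 _ _ v _ _ d); rewrite Ed ?expf_neq0 // => j jd.
  have [->|pj] := eqVneq (p j) 0; first by left; rewrite peval0 !mul0r.
  have ltjd : (j < d)%N by rewrite ltn_neqAle maxd // andbT (inj_eq val_inj).
  have -> : peval f (p j) * w ^+ j * peval f (p d) ^+ d.-1 =
      peval f (p j * p d ^+ (d.-1 - j)%N) * W ^+ j.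
    rewrite pevalM pevalXn /W exprMn.
    by rewrite -[X in _ * _ ^+ X = _](subnK (_ : j <= d.-1)%N) ?exprD; [ring | lia].
  apply: (ord_geM' (op _) (_ : ord_ge v (j%:Z * ord v W) _)); first by right; rewrite ordXn.
  have le : (size (p j * p d ^+ (d.-1 - j)%N)%R <= c)%N.
    exact: (leq_bigmax (F := fun j : 'I_N => size (p j * p d ^+ (d.-1 - j)%N)%R)).
  rewrite ordXn; set S := size _ in le *.
  have {ltW} ltW : ord v W + 1 <= - (c * k)%:Z by lia.
  have leS : - (c * k)%:Z <= - (S * k)%:Z by nia.
  nia.
by rewrite -mulr_suml E mul0r eqxx.
Qed.

Definition independent_over f (n : nat) (z : 'I_n -> F) :=
  forall p : 'I_n -> {poly C}, \sum_i peval f (p i) * z i = 0 -> forall i, p i = 0.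

(** The [m (k + 1)] functions [f^j w_i] with [j <= k], for [w_i] integral over
    [C[f]], lie in a space of dimension at most [k deg s + O(1)]. *)
Lemma independent_le_poles f s (m : nat) (w : 'I_m -> F) : nonconstant f ->
  (forall v, ord_ge v (- (count_mem v s)%:Z) f) -> independent_over f w -> (m <= size s)%N.
Proof.
move=> nf Hs ind; rewrite leqNgt; apply/negP => lt.
have /choice[qc Hqc] : forall i, exists qc : {poly C} * nat, qc.1 != 0 /\
   forall v (k : nat), ord_ge v (- k%:Z) f -> ord_ge v (- (qc.2 * k)%:Z) (peval f qc.1 * w i).
  by move=> i; have [q [c H]] := integral_multiple (w i) nf; exists (q, c).
pose c := \max_(i < m) (qc i).2.
pose k := ((c * size s) + 1)%N.
have sz_flat (l : nat) : size (flatten (nseq l s)) = (l * size s)%N.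
  by elim: l => //= l IH; rewrite size_cat IH mulSn.
have count_flat v (l : nat) : count_mem v (flatten (nseq l s)) = (l * count_mem v s)%N.
  by elim: l => //= l IH; rewrite count_cat IH mulSn.
have fX v (l : nat) : ord_ge v (- (l * count_mem v s)%:Z) (f ^+ l).
  elim: l => [|l IH]; first by rewrite expr0; right; rewrite ord_one.
  by rewrite exprS; apply: (ord_geM' (Hs v) IH); rewrite mulSn PoszD opprD.
have [|i v|a [[[i0 j0] aij] E]] := @sections_dependent_fin (flatten (nseq (c + k) s))
  ('I_m * 'I_k.+1)%type (fun ij => f ^+ ij.2 * (peval f (qc ij.1).1 * w ij.1)).
- rewrite sz_flat card_prod !card_ord; nia.
- have le_c : ((qc i.1).2 <= c)%N by exact: leq_bigmax.
  have le_k : (i.2 <= k)%N by rewrite -ltnS.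
  apply: (ord_geM' (fX v i.2) ((Hqc i.1).2 v _ (Hs v))).
  rewrite count_flat; set cv := count_mem v s; set q2 := (qc _).2 in le_c *.
  by rewrite -opprD lerN2 -PoszD lez_nat -mulnDl addnC leq_mul2r leq_add ?orbT.
suff /ind/(_ i0)/eqP : \sum_i peval f ((\poly_(j < k.+1) a (i, inord j)) * (qc i).1) * w i = 0.
  rewrite mulf_eq0 (negPf (Hqc i0).1) orbF => /eqP/polyP/(_ j0).
  by rewrite coef_poly ltn_ord inord_val coef0 => /eqP; rewrite (negPf aij).
rewrite -[RHS]E; transitivity (\sum_i \sum_(j < k.+1) iota (a (i, j)) *
    (f ^+ j * (peval f (qc i).1 * w i))); last by rewrite pair_bigA; apply: eq_bigr => -[].
apply: eq_bigr => i _; rewrite pevalM (@pevalE _ _ f _ k.+1) ?size_poly //.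
rewrite -mulrA mulr_suml; apply: eq_bigr => j _.
by rewrite coef_poly ltn_ord inord_val; ring.
Qed.

End ProductFormula.

Lemma count_take_lt (T : eqType) (s : seq T) (x0 : T) (k l : nat) : (k < l <= size s)%N ->
  (count_mem (nth x0 s k) (take k s) < count_mem (nth x0 s k) (take l s))%N.
Proof.
move=> /andP[kl ls]; have ks : (k < size s)%N by exact: leq_trans kl ls.
rewrite -[in X in (_ < X)%N](subnKC kl) takeD count_cat (take_nth x0 ks).
by rewrite -cats1 count_cat /= eqxx; lia.
Qed.

Section Degree.
Context (R : realType) (X : curve R).
Local Notation C := R[i].
Local Notation F := (fun_field X).
Local Notation iota := (const X).
Local Notation point := (Defs.point X).
Implicit Types (f h w x y z t : F) (u v : point) (s : seq point) (D : divisor X).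

(** For each occurrence of a point [v] in [s], take a function that vanishes to the
    full multiplicity at the other points, and at [v] to the order given by the
    number of earlier occurrences.  Modulo [f], a relation over [C[f]] becomes a
    relation over [C], whose term of lowest order at its point cannot cancel. *)
Lemma zeros_independent f s : nonconstant f ->
  (forall v, v \in s -> (count_mem v s)%:Z <= ord v f) ->
  exists w : 'I_(size s) -> F, independent_over f w.
Proof.
move=> nf Hs; pose pt (k : 'I_(size s)) := tnth (in_tuple s) k.
pose mult (k : 'I_(size s)) := count_mem (pt k) (take k s).
have ptE k (x0 : point) : pt k = nth x0 s k by rewrite /pt (tnth_nth x0).
have pts k : pt k \in s by exact: mem_tnth.
have multlt k : (mult k < count_mem (pt k) s)%N.
  rewrite /mult (ptE k (pt k)); have := @count_take_lt _ s (pt k) k (size s).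
  by rewrite take_size ltn_ord leqnn; apply.
have /choice[w Hw] : forall k, exists w, [/\ w != 0, ord (pt k) w = mult k
    & forall u, u \in s -> u != pt k -> (count_mem u s)%:Z <= ord u w].
  move=> k; pose t := uniformizer (pt k); have t0 : t != 0 := uniformizer_neq0 _.
  pose n := \max_(u <- s) (count_mem u s + `|ord u (t ^+ mult k)|)%N.
  have [|e [e0 pe He]] := @approximate_indicator _ _ (pt k) [seq u <- s | u != pt k] n.
    by rewrite mem_filter eqxx.
  exists (e * t ^+ mult k); rewrite mulf_neq0 ?expf_neq0 //; split=> //.
    by rewrite ordM ?expf_neq0 // pe ordXn ord_uniformizer; lia.
  move=> u us uk; rewrite ordM ?expf_neq0 //.
  have {}He : n%:Z <= ord u e by apply: He; rewrite mem_filter uk.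
  have : (count_mem u s + `|ord u (t ^+ mult k)| <= n)%N by exact: leq_bigmax_seq.
  move: (count_mem u s) (ord u (t ^+ mult k)) n He => a b c; lia.
have w_ge0 k u : u \in s -> 0 <= ord u (w k).
  have [_ wk Hk] := Hw k; have [->|ne] := eqVneq u (pt k); first by rewrite wk.
  by move=> us; apply: le_trans (Hk u us ne).
exists w => p E; apply: contrapT => /existsNP[i /eqP pi].
have [q [[j qj] {}E]] := normalized_relation (nonconstant_neq0 nf) (ex_intro _ i pi) E.
have [k qk mink] : exists2 k, (q k)`_0 != 0 & forall l, (q l)`_0 != 0 -> (k <= l)%N.
  by case: (@arg_minnP _ j (fun k => (q k)`_0 != 0) (@nat_of_ord _) qj) => l ? ?; exists l.
set v := pt k; have vs : v \in s := pts k.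
have f0 := nonconstant_neq0 nf.
have vf : (count_mem v s)%:Z <= ord v f by exact: Hs.
have ltk : (mult k)%:Z + 1 <= (count_mem v s)%:Z by rewrite lezD1 ltz_nat; exact: multlt.
have vf1 : ord_ge v 1 f.
  by right; apply: le_trans vf; apply: le_trans ltk; rewrite lerDr.
have [wk0 wk _] := Hw k.
have [qk0 oqk] := ord_peval_unit vf1 qk.
suff : \sum_l peval f (q l) * w l != 0 by rewrite E eqxx.
apply: (@dominated_sum_neq0 _ _ v _ _ k); first by rewrite mulf_neq0.
rewrite ordM // oqk add0r wk => l lk.
have [wl0 wl Hl] := Hw l.
have [ql0|ql0] := eqVneq (q l)`_0 0; last first.
  have ltkl : (k < l)%N.
    by rewrite ltn_neqAle mink // andbT eq_sym (inj_eq val_inj).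
  have [ql oql] := ord_peval_unit vf1 ql0.
  right; rewrite ordM // oql add0r; have [evl|nvl] := eqVneq v (pt l); last first.
    exact: le_trans ltk (Hl v vs nvl).
  rewrite evl wl lezD1 ltz_nat /mult -evl /v (ptE k (pt k)).
  by apply: count_take_lt; rewrite ltkl ltnW.
have [q' ->] : exists q', q l = q' * 'X.
  elim/poly_ind: (q l) ql0 => [_|q' c _]; first by exists 0; rewrite mul0r.
  by rewrite coefD coefMX coefC add0r /= => ->; exists q'; rewrite addr0.
rewrite pevalM pevalX; apply: (ord_geM' (n := (count_mem v s)%:Z) (m := 0)).
- rewrite -[X in ord_ge _ X]add0r; apply: ord_geM; last by right.
  by apply: ord_ge_peval; apply: ord_geW vf1.
- by right; exact: w_ge0.
- by rewrite addr0.
Qed.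

Lemma finite_zeros f : nonconstant f ->
  exists s : seq point, forall v, v \notin s -> ord v f <= 0.
Proof.
move=> nf; apply: contrapT => no.
have many n : exists2 s, uniq s & size s = n /\ forall v, v \in s -> 1 <= ord v f.
  elim: n => [|n [s us [ss Hs]]]; first by exists [::].
  have [v vs vf] : exists2 v, v \notin s & ~~ (ord v f <= 0).
    apply: contrapT => no'; apply: no; exists s => v vs; apply: contrapT => /negP vf.
    by apply: no'; exists v.
  exists (v :: s); rewrite /= ?vs //; split=> [|u]; first by rewrite ss.
  by rewrite inE => /orP[/eqP->|/Hs//]; lia.
have [N HN] := bounded_independence nf.
have [s us [ss Hs]] := many N.
have [v vs|w ind] := @zeros_independent f s nf; first by rewrite count_uniq_mem // vs; exact: Hs.
rewrite ss in w ind; have [p [[j pj] E]] := HN w.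
by move: pj; rewrite (ind p E j) coef0 eqxx.
Qed.

Lemma finite_support f : f != 0 -> exists s : seq point, forall v, v \notin s -> ord v f = 0.
Proof.
move=> f0; have [nf|cf] := pselect (nonconstant f); last first.
  have [c ->] := nonconstantPn cf; exists [::] => v _; exact: ord_const.
have [s Hs] := finite_zeros nf; have [s' Hs'] := finite_zeros (nonconstantV nf).
exists (s ++ s') => v; rewrite mem_cat negb_or => /andP[/Hs vf /Hs'].
by rewrite ordV; lia.
Qed.

(** A list with multiplicities is the form in which zeros and poles are counted. *)
Definition pos_part D : seq point :=
  flatten [seq nseq `|Num.max (coeff v D) 0| v | v <- dom D].

Lemma count_pos_part D v : (count_mem v (pos_part D))%:Z = Num.max (coeff v D) 0.
Proof.
rewrite /pos_part count_flatten -map_comp sumnE big_map.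
rewrite (eq_bigr (fun u => if u == v then `|Num.max (coeff v D) 0|%N else 0%N)); last first.
  by move=> u _ /=; rewrite count_nseq /= eq_sym; case: eqVneq => [->|]; rewrite ?mul1n.
rewrite -big_mkcond /= -big_filter; have [vD|vD] := boolP (v \in dom D).
  rewrite filter_pred1_uniq ?uniq_dom // big_seq1; lia.
rewrite coeff_outdom // (@eq_in_filter _ _ pred0) ?filter_pred0 ?big_nil //.
by move=> u uD /=; apply: contraNF vD => /eqP <-.
Qed.

Lemma size_pos_part D : (size (pos_part D))%:Z = \sum_(v <- dom D) Num.max (coeff v D) 0.
Proof.
rewrite /pos_part size_flatten /shape -map_comp sumnE big_map.
rewrite (big_morph Posz PoszD (erefl 0%:Z)); apply: eq_bigr => v _ /=.
by rewrite size_nseq; lia.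
Qed.

Lemma degE D : deg D = \sum_(v <- dom D) coeff v D.
Proof.
rewrite -[in LHS](freeg_sumE D) raddf_sum; apply: eq_bigr => v _; exact: degU.
Qed.

(** Were the zeros of [f] more numerous than its poles, they would give too many
    functions independent over [C[f]]. *)
Lemma deg_le0 f D : f != 0 -> (forall v, coeff v D <= ord v f) -> deg D <= 0.
Proof.
move=> f0 HD; have degDE : deg D = (size (pos_part D))%:Z - (size (pos_part (- D)))%:Z.
  rewrite !size_pos_part (perm_big _ (domN_perm_eq D)) degE -sumrB.
  by apply: eq_bigr => v _; rewrite coeffN; lia.
have [nf|cf] := pselect (nonconstant f); last first.
  have [c fc] := nonconstantPn cf; rewrite degE big_seq sumr_le0 // => v _.
  by rewrite (le_trans (HD v)) // fc ord_const.
rewrite degDE subr_le0 lez_nat.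
have [v vp|w ind] := @zeros_independent f (pos_part D) nf.
  rewrite count_pos_part; apply: le_trans (HD v).
  have : (0 < count_mem v (pos_part D))%N by rewrite -has_count has_pred1.
  rewrite -ltz_nat count_pos_part; lia.
apply: independent_le_poles nf _ ind => v; right; rewrite count_pos_part coeffN.
have := HD v; lia.
Qed.

End Degree.

(** * Rank two bundles *)

Section Bundles.
Context (R : realType) (X : curve R).
Local Notation C := R[i].
Local Notation F := (fun_field X).
Local Notation iota := (const X).
Local Notation point := (Defs.point X).
Implicit Types (f h : F) (v : point) (L D : divisor X) (E : bundle X) (u : 'cV[F]_2).

Lemma ord2P (i : 'I_2) : i = 0 \/ i = 1.
Proof. by case: i => -[|[|//]] ?; [left | right]; apply: val_inj. Qed.

Lemma sum2E (V : nmodType) (a : 'I_2 -> V) : \sum_i a i = a 0 + a 1.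
Proof.
by rewrite big_ord_recl big_ord1; congr (_ + a _); apply: val_inj.
Qed.

Lemma ord_geZ v (n m : int) f h : f != 0 -> ord v f = m ->
  ord_ge v n (f * h) <-> ord_ge v (n - m) h.
Proof.
move=> f0 fm; have [->|h0] := eqVneq h 0.
  by rewrite mulr0; split=> _; left.
rewrite !ord_geP ?mulf_neq0 // ordM // fm; split; lia.
Qed.

Lemma mx_ord_geM m n p v (a b : int) (A : 'M[F]_(m, n)) (B : 'M[F]_(n, p)) :
  mx_ord_ge v a A -> mx_ord_ge v b B -> mx_ord_ge v (a + b) (A *m B).
Proof.
by move=> HA HB i j; rewrite mxE; apply: ord_ge_sum => k _; exact: ord_geM.
Qed.

Lemma mx_ord_geD m n v (a : int) (A B : 'M[F]_(m, n)) :
  mx_ord_ge v a A -> mx_ord_ge v a B -> mx_ord_ge v a (A + B).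
Proof. by move=> HA HB i j; rewrite mxE; exact: ord_geD. Qed.

Lemma mx_ord_ge_scale m n v (a b : int) f (A : 'M[F]_(m, n)) :
  ord_ge v a f -> mx_ord_ge v b A -> mx_ord_ge v (a + b) (f *: A).
Proof. by move=> Hf HA i j; rewrite mxE; exact: ord_geM. Qed.

Lemma ord_ge_det n v (A : 'M[F]_n) : mx_ord_ge v 0 A -> ord_ge v 0 (\det A).
Proof.
move=> HA; apply: ord_ge_sum => s _; rewrite -[0]addr0; apply: ord_geM.
  apply: ord_geXn; by right; rewrite ordN1.
apply: (big_ind (ord_ge v 0)) => //; first by right; rewrite ord_one.
by move=> a b Ha Hb; rewrite -[0]addr0; exact: ord_geM.
Qed.

Lemma mx_ord_ge_inv n v (A : 'M[F]_n) : A \in unitmx -> mx_ord_ge v 0 A ->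
  ord v (\det A) = 0 -> mx_ord_ge v 0 (invmx A).
Proof.
move=> uA HA dA; rewrite /invmx uA -[0]addr0; apply: mx_ord_ge_scale.
  by right; rewrite ordV dA.
move=> i j; rewrite mxE /cofactor -[0]addr0; apply: ord_geM.
  apply: ord_geXn; by right; rewrite ordN1.
by apply: ord_ge_det => k l; rewrite !mxE; exact: HA.
Qed.

(** The least order of the entries, characterized by the multiples of [A] that are
    regular: in this form it can be compared with the stalks of a line bundle. *)
Lemma mx_ord_eqP m n v (a : int) (A : 'M[F]_(m, n)) :
  mx_ord_eq v a A <-> forall f, mx_ord_ge v 0 (f *: A) <-> ord_ge v (- a) f.
Proof.
have t0 := uniformizer_neq0 v.
split=> [[HA [i [j [Aij0 oA]]]] f|H].
  split=> [/(_ i j)|Hf]; last by rewrite -(addNr a); exact: mx_ord_ge_scale.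
  by rewrite mxE mulrC => /(ord_geZ _ _ Aij0 oA); rewrite sub0r.
have tz k : ord v (uniformizer v ^ k) = k by rewrite ordXz ord_uniformizer mulr1.
have tz0 k : uniformizer v ^ k != 0 by rewrite expfz_neq0.
split=> [i j|].
  have /(H _)/(_ i j) : ord_ge v (- a) (uniformizer v ^ (- a)) by right; rewrite tz.
  by rewrite mxE => /(ord_geZ _ _ (tz0 _) (tz _)); rewrite sub0r opprK.
have no : ~ mx_ord_ge v 0 (uniformizer v ^ (- a - 1) *: A).
  move/H/(ord_geN0 (tz0 _)); by rewrite tz lerDl.
apply: contrapT => none; apply: no => i j; rewrite mxE.
apply/(ord_geZ _ _ (tz0 _) (tz _)).
have [Aij|A0] := eqVneq (A i j) 0; first by left.
have /(H _)/(_ i j) : ord_ge v (- a) (uniformizer v ^ (- a)) by right; rewrite tz.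
rewrite mxE => /(ord_geZ _ _ (tz0 _) (tz _))/(ord_geN0 A0).
rewrite sub0r opprK => ge; right; rewrite sub0r opprD !opprK.
have [e|ne] := eqVneq (ord v (A i j)) a; last first.
  have H1 : a + 1 <= ord v (A i j) by lia.
  exact: H1.
by exfalso; apply: none; exists i, j.
Qed.

Lemma stalkD E v u u' : stalk E v u -> stalk E v u' -> stalk E v (u + u').
Proof. by move=> Hu Hu'; rewrite /stalk mulmxDr; exact: mx_ord_geD. Qed.

Lemma stalk0 E v : stalk E v 0.
Proof. by move=> i j; rewrite mulmx0 mxE; left. Qed.

Lemma stalk_frame E v w : stalk E v (frame E v *m w) <-> mx_ord_ge v 0 w.
Proof. by rewrite /stalk mulKmx ?frame_unit. Qed.

Lemma line_subbundleP E L u : u != 0 ->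
  line_subbundle E L u <-> forall v f, stalk E v (f *: u) <-> in_stalk L v f.
Proof.
move=> u0; have H v f : stalk E v (f *: u) <-> mx_ord_ge v 0 (f *: (invmx (frame E v) *m u)).
  by rewrite /stalk -scalemxAr.
split=> [[_ Hu] v f|Hu]; first by rewrite H; have /mx_ord_eqP := Hu v; exact.
by split=> // v; apply/mx_ord_eqP => f; rewrite -H; exact: Hu.
Qed.

(** The determinant line bundle of [E]. *)
Definition det_div E : divisor X :=
  \sum_(v <- undup (bad E)) << (- ord v (\det (frame E v))) *g v >>.

Lemma coeff_sum_seq (s : seq point) (a : point -> int) v : uniq s ->
  coeff v (\sum_(x <- s) << a x *g x >>) = if v \in s then a v else 0.
Proof.
move=> us; rewrite raddf_sum /=; under eq_bigr do rewrite coeffU.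
case: ifP => vs; last first.
  rewrite big_seq big1 // => x xs; case: eqVneq => [e|]; last by rewrite mulr0.
  by rewrite -e xs in vs.
rewrite (bigD1_seq v) //= eqxx mulr1 big1 ?addr0 // => x /negPf xv.
by rewrite xv mulr0.
Qed.

Lemma coeff_det_div E v : coeff v (det_div E) = - ord v (\det (frame E v)).
Proof.
rewrite coeff_sum_seq ?undup_uniq // mem_undup; case: ifPn => // vb.
by rewrite frame_good // det1 ord_one oppr0.
Qed.

Lemma deg_det_div E : deg (det_div E) = bdeg E.
Proof.
rewrite /det_div raddf_sum /= /bdeg -sumrN; apply: eq_bigr => v _; exact: degU.
Qed.

Lemma deg_coeff D D' : (forall v, coeff v D = coeff v D') -> deg D = deg D'.
Proof. by move=> H; congr deg; apply/eqP/freeg_eqP. Qed.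

Lemma det_frame_neq0 E v : \det (frame E v) != 0.
Proof. by rewrite -unitfE -unitmxE frame_unit. Qed.

Lemma ord_det_dsum L0 L1 v : ord v (\det (dsum_frame L0 L1 v)) = - (coeff v L0 + coeff v L1).
Proof.
rewrite det_diag big_ord_recl big_ord1 !mxE /= ordM ?expfz_neq0 ?uniformizer_neq0 //.
by rewrite !ordXz !ord_uniformizer; lia.
Qed.

Lemma bdeg_dsum L0 L1 : bdeg (dsum L0 L1) = deg L0 + deg L1.
Proof.
rewrite -deg_det_div -degD; apply: deg_coeff => v.
by rewrite coeff_det_div /= ord_det_dsum coeffD opprK.
Qed.

Lemma invmx_dsum_frame L0 L1 v : invmx (dsum_frame L0 L1 v) = dsum_frame (- L0) (- L1) v.
Proof.
have t0 := uniformizer_neq0 v.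
apply: (can_inj (mulKmx (dsum_frame_unit L0 L1 v))); rewrite mulmxV ?dsum_frame_unit //.
rewrite /dsum_frame mulmx_diag -diag_const_mx; congr diag_mx; apply/rowP => i.
by rewrite !mxE; case: ifP => _; rewrite -expfzDr // coeffN opprK addNr expr0z.
Qed.

Lemma stalk_dsum L0 L1 v u :
  stalk (dsum L0 L1) v u <-> in_stalk L0 v (u 0 0) /\ in_stalk L1 v (u 1 0).
Proof.
rewrite /stalk /= invmx_dsum_frame mul_diag_mx.
have t0 k : uniformizer v ^ k != 0 by rewrite expfz_neq0 ?uniformizer_neq0.
have ot k : ord v (uniformizer v ^ k) = k by rewrite ordXz ord_uniformizer mulr1.
have e L h : ord_ge v 0 (uniformizer v ^ (- coeff v (- L)) * h) <-> in_stalk L v h.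
  by rewrite (ord_geZ _ _ (t0 _) (ot _)) coeffN opprK sub0r.
split=> [H|[H0 H1] i j].
  by split; [have := H 0 0 | have := H 1 0]; rewrite !mxE /= => /e.
by rewrite !mxE (ord1 j); case: (ord2P i) => ->; apply/e.
Qed.

Lemma dsum_frame_col L0 L1 v (i : 'I_2) :
  dsum_frame L0 L1 v *m delta_mx i 0 =
    uniformizer v ^ (- coeff v (if i == 0 then L0 else L1)) *: delta_mx i 0 :> 'cV_2.
Proof.
rewrite /dsum_frame mul_diag_mx; apply/colP => k; rewrite !mxE.
by have [->|] := eqVneq k i; rewrite ?mulr0.
Qed.

Lemma mulmx_col2 (G : 'M[F]_2) u : G *m u = u 0 0 *: col 0 G + u 1 0 *: col 1 G.
Proof. by apply/colP => i; rewrite !mxE sum2E ![_ * G _ _]mulrC. Qed.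

Section TwoSections.
Variables (E : bundle X) (L0 L1 : divisor X) (G : 'M[F]_2).
Hypotheses (uG : G \in unitmx)
  (G0 : forall v f, in_stalk L0 v f -> stalk E v (f *: col 0 G))
  (G1 : forall v f, in_stalk L1 v f -> stalk E v (f *: col 1 G)).

Let N v := invmx (frame E v) *m G *m dsum_frame L0 L1 v.

Let N_integral v : mx_ord_ge v 0 (N v).
Proof.
move=> i j; have -> : N v i j = (invmx (frame E v) *m (G *m (dsum_frame L0 L1 v *m delta_mx j 0)
    : 'cV_2)) i 0.
  by rewrite !mulmxA -colE [RHS]mxE.
suff H : stalk E v (G *m (dsum_frame L0 L1 v *m delta_mx j 0)) by exact: H.
rewrite dsum_frame_col -scalemxAr -colE.
have tz k : ord_ge v k (uniformizer v ^ k) by right; rewrite ordXz ord_uniformizer mulr1.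
by case: (ord2P j) => ->; [apply: G0 | apply: G1]; apply: tz.
Qed.

Let N_unit v : N v \in unitmx.
Proof. by rewrite !unitmx_mul unitmx_inv frame_unit uG dsum_frame_unit. Qed.

Let detG0 : \det G != 0. Proof. by rewrite -unitfE -unitmxE. Qed.

Let ord_detN v : ord v (\det (N v)) = ord v (\det G) + coeff v (det_div E) - coeff v (L0 + L1).
Proof.
have detf0 := det_frame_neq0 E v.
have detd0 : \det (dsum_frame L0 L1 v) != 0 by rewrite -unitfE -unitmxE dsum_frame_unit.
rewrite !det_mulmx det_inv !ordM ?mulf_neq0 ?invr_eq0 // ordV ord_det_dsum.
by rewrite coeff_det_div coeffD [- _ + _]addrC.
Qed.

Let ord_detN_ge0 v : 0 <= ord v (\det (N v)).
Proof.
by apply: ord_geN0; [rewrite -unitfE -unitmxE | exact: ord_ge_det].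
Qed.

(** The determinant of [O(L0) + O(L1) -> E] is a section of
    [det E (- L0 - L1)]. *)
Lemma deg_two_sections : deg L0 + deg L1 <= bdeg E.
Proof.
rewrite -deg_det_div -degD -subr_le0 -degB; apply: (deg_le0 detG0) => v.
by have := ord_detN_ge0 v; rewrite ord_detN coeffB; lia.
Qed.

(** When the degrees agree, that section has no zero, so the inclusion is an
    isomorphism at every point. *)
Lemma stalk_two_sections : deg L0 + deg L1 = bdeg E -> forall v u,
  stalk E v (G *m u) <-> stalk (dsum L0 L1) v u.
Proof.
move=> eqdeg v u; split; last first.
  by case/stalk_dsum=> /G0 H0 /G1 H1; rewrite mulmx_col2; exact: stalkD.
have oN : ord v (\det (N v)) = 0.
  apply/eqP; rewrite eq_le ord_detN_ge0 andbT leNgt; apply/negP => gt.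
  have : deg (L0 + L1 - det_div E + << 1 *g v >>) <= 0.
    apply: (deg_le0 detG0) => w; rewrite coeffD coeffU mul1r coeffB.
    have := ord_detN_ge0 w; rewrite ord_detN.
    case: eqVneq => [e|_]; last by rewrite addr0; lia.
    by move: gt; rewrite ord_detN -e /=; lia.
  by rewrite degD degU degB deg_det_div degD eqdeg subrr.
move=> Hu; rewrite /stalk /= -(mulKmx (N_unit v) (invmx _ *m u)) -[0]addr0.
apply: mx_ord_geM; first exact: mx_ord_ge_inv.
by rewrite /N mulmxA (mulmxK (dsum_frame_unit L0 L1 v)) -mulmxA.
Qed.

End TwoSections.

Lemma deg_independent E L0 L1 (G : 'M[F]_2) : G \in unitmx ->
  line_subbundle E L0 (col 0 G) -> line_subbundle E L1 (col 1 G) ->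
  deg L0 + deg L1 <= bdeg E.
Proof.
move=> uG H0 H1; apply: (deg_two_sections uG) => v f.
  by have [n0 _] := H0; move: H0 => /(line_subbundleP _ _ n0)/(_ v f)[].
by have [n0 _] := H1; move: H1 => /(line_subbundleP _ _ n0)/(_ v f)[].
Qed.

Lemma deg_le_sections L L' h : h != 0 ->
  (forall v f, in_stalk L v f -> in_stalk L' v (f * h)) -> deg L <= deg L'.
Proof.
move=> h0 H; rewrite -subr_le0 -degB; apply: (deg_le0 h0) => v.
have t0 k : uniformizer v ^ k != 0 by rewrite expfz_neq0 ?uniformizer_neq0.
have ot k : ord v (uniformizer v ^ k) = k by rewrite ordXz ord_uniformizer mulr1.
have /H : in_stalk L v (uniformizer v ^ (- coeff v L)) by right; rewrite ot.
by move/(ord_geZ _ _ (t0 _) (ot _))/(ord_geN0 h0); rewrite coeffB; lia.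
Qed.

(** The order of [u] at [v] as a section of [E] vanishes for almost all [v], since a
    function has finitely many zeros and poles. *)
Lemma saturation E u : u != 0 -> exists L, line_subbundle E L u.
Proof.
move=> u0; pose w v := invmx (frame E v) *m u.
have w0 v : w v != 0.
  apply: contra_neq u0 => e.
  by rewrite -(mulKVmx (frame_unit E v) u) -/(w v) e mulmx0.
have /choice[a Ha] : forall v, exists a, mx_ord_eq v a (w v).
  move=> v; have /cV0Pn[i0 wi0] := w0 v.
  have [i wi mini] : exists2 i, w v i 0 != 0 & forall j, w v j 0 != 0 ->
      ord v (w v i 0) <= ord v (w v j 0).
    by case: (@arg_minP _ _ _ i0 (fun i => w v i 0 != 0) (fun i => ord v (w v i 0)) wi0) => i;
       exists i.
  exists (ord v (w v i 0)); split; last by exists i, 0.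
  move=> j k; rewrite (ord1 k); have [->|wj] := eqVneq (w v j 0) 0; first by left.
  by right; exact: mini.
have /choice[s Hs] : forall i, exists s : seq point, forall v,
    v \notin s -> u i 0 != 0 -> ord v (u i 0) = 0.
  move=> i; have [ui|ui] := eqVneq (u i 0) 0; first by exists [::].
  by have [s Hs] := finite_support ui; exists s => v /Hs.
pose S := undup (bad E ++ s 0 ++ s 1).
exists (\sum_(v <- S) << a v *g v >>); split=> // v.
rewrite coeff_sum_seq ?undup_uniq //; case: ifPn => // vS.
suff <- : a v = 0 by exact: Ha.
move: vS; rewrite mem_undup !mem_cat !negb_or => /and3P[vb v0 v1].
have [_ [i [j []]]] := Ha v; rewrite /w frame_good // invmx1 mul1mx (ord1 j).
move=> ui <-; by case: (ord2P i) ui => -> ui; exact: Hs.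
Qed.

End Bundles.

(** * Degenerations of Higgs bundles *)

Section HiggsBundles.
Context (R : realType) (X : curve R) (K : divisor X).
Local Notation C := R[i].
Local Notation F := (fun_field X).
Local Notation iota := (const X).
Local Notation point := (Defs.point X).
Implicit Types (f h : F) (v : point) (L D : divisor X) (E : bundle X) (u : 'cV[F]_2).
Implicit Types (H : higgs K).

Lemma ord_uniformizerXz v (k : int) : ord v (uniformizer v ^ k) = k.
Proof. by rewrite ordXz ord_uniformizer mulr1. Qed.

Lemma uniformizerXz_neq0 v (k : int) : uniformizer v ^ k != 0.
Proof. by rewrite expfz_neq0 ?uniformizer_neq0. Qed.

Lemma ord_ge_uniformizerXz v (k : int) : ord_ge v k (uniformizer v ^ k).
Proof. by right; rewrite ord_uniformizerXz. Qed.

(** A frame-free form of regularity: [phi] twisted by [K] preserves the stalks. *)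
Lemma higgs_fieldP E (phi : 'M[F]_2) : is_higgs_field K E phi <->
  forall v u f, ord_ge v (coeff v K) f -> stalk E v u -> stalk E v (f *: (phi *m u)).
Proof.
split=> [Hphi v u f Hf Hu|Hphi v i j].
  rewrite /stalk -scalemxAr -(addrN (coeff v K)); apply: mx_ord_ge_scale => //.
  rewrite -(mulKVmx (frame_unit E v) u) !mulmxA -(mulmxA (_ *m frame E v)).
  rewrite -[X in mx_ord_ge v X]addr0.
  by apply: mx_ord_geM => //; exact: Hphi.
have /Hphi/(_ i 0) : stalk E v (frame E v *m delta_mx j 0).
  by apply/stalk_frame => k l; rewrite mxE; right; case: (_ && _); rewrite ?ord_one ?Defs.ord0.
move/(_ _ (ord_ge_uniformizerXz v _)).
rewrite -scalemxAr !mulmxA -colE !mxE.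
by move/(ord_geZ _ _ (uniformizerXz_neq0 _ _) (ord_uniformizerXz _ _)); rewrite sub0r.
Qed.

Lemma coefp_mul (Q : 'M[F]_2) (w : 'cV[{poly F}]_2) n :
  map_mx (coefp n) (map_mx polyC Q *m w) = Q *m map_mx (coefp n) w.
Proof.
apply/colP => i; rewrite !mxE /coefp coef_sum; apply: eq_bigr => j _.
by rewrite !mxE /= coefCM.
Qed.

(** The Rees degeneration of [H] along the line subbundle spanned by the first
    column of [Q]: the family of lattices [Q diag(1, t)]. *)
Lemma degenerates_dsum H H0 L0 L1 gamma (Q : 'M[F]_2) : Q \in unitmx ->
  hbundle H0 = dsum L0 L1 -> hfield H0 = gamma *: delta_mx 1 0 ->
  (invmx Q *m hfield H *m Q) 1 0 = gamma ->
  (forall v f, stalk H v (f *: col 0 Q) <-> in_stalk L0 v f) ->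
  (forall v f, (exists h, stalk H v (h *: col 0 Q + f *: col 1 Q)) <-> in_stalk L1 v f) ->
  degenerates_to H H0.
Proof.
move=> uQ bH0 fH0 g10 S0 S1; set A := invmx Q *m hfield H *m Q in g10.
pose d : 'rV[{poly F}]_2 := \row_i (if i == 0 then 1 else 'X).
pose Theta : 'M[{poly F}]_2 := \matrix_(i, j)
  if i == j then 'X * (A i j)%:P else if i == 0 then 'X ^+ 2 * (A i j)%:P else (A i j)%:P.
pose P := map_mx polyC Q *m diag_mx d.
have colsQ (w : 'cV[{poly F}]_2) n : map_mx (coefp n) (P *m w) =
    (w 0 0)`_n *: col 0 Q + ('X * w 1 0)`_n *: col 1 Q.
  by rewrite /P -mulmxA coefp_mul mulmx_col2 mul_diag_mx !mxE /= mul1r.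
exists P, Theta, 1%N, (\det Q); split.
- by rewrite -unitfE -unitmxE.
- rewrite /P det_mulmx det_map_mx det_diag big_ord_recl big_ord1 !mxE /= mul1r.
  by rewrite mul_polyC.
- rewrite /P mulmxA -map_mxM -(mulKVmx uQ (hfield H *m Q)) (mulmxA (invmx Q)) -/A.
  rewrite map_mxM -!mulmxA scalemxAr; congr (_ *m _).
  apply/matrixP => i j; rewrite mul_diag_mx mul_mx_diag !mxE.
  by case: (ord2P i) (ord2P j) => -> [] -> /=; ring.
- rewrite fH0 -g10; apply/matrixP => i j; rewrite !mxE.
  by case: (ord2P i) (ord2P j) => -> [] -> /=;
     rewrite /coefp ?expr2 -?mulrA ?coefXM ?coefC ?mulr0 ?mulr1.
move=> v u0; rewrite bH0 stalk_dsum; split=> [[/S0 H00 /S1[h H01]]|[u [-> Hu]]].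
  exists (\col_i if i == 0 then (u0 0 0)%:P + h *: 'X else (u0 1 0)%:P); split.
    apply/colP => i; rewrite !mxE; case: (ord2P i) => -> /=; last by rewrite /coefp coefC.
    by rewrite /coefp coefD coefC coefZ coefX mulr0 addr0.
  move=> n; rewrite colsQ !mxE /= coefXM !coefE.
  case: n => [|[|n]] /=; rewrite ?mulr0 ?mulr1 ?addr0 ?add0r ?scale0r ?addr0 ?add0r //.
  exact: stalk0.
split.
  by apply/S0; have := Hu 0%N; rewrite colsQ !mxE coefXM /= scale0r addr0.
by apply/S1; exists (u 0 0)`_1; have := Hu 1%N; rewrite colsQ !mxE coefXM /=.
Qed.

Lemma higgs_iso_refl H : higgs_iso H H.
Proof.
by exists 1%:M; rewrite unitmx1 mul1mx mulmx1; split=> // v u; rewrite mul1mx.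
Qed.

Lemma degenerates_limit H H0 : degenerates_to H H0 -> in_moduli H0 -> is_limit H H0.
Proof. by move=> dH mH0; exists H0; split=> //; left; exact: higgs_iso_refl. Qed.

Definition stable_higgs H := forall L u, line_subbundle H L u ->
  (exists a, hfield H *m u = a *: u) -> 2 * deg L < bdeg H.

Lemma coefp_mul_low (P : 'M[{poly F}]_2) n q (W : 'M[{poly F}]_(2, q)) :
  (forall k, (k < n)%N -> map_mx (coefp k) P = 0) ->
  map_mx (coefp n) (P *m W) = map_mx (coefp n) P *m map_mx (coefp 0) W.
Proof.
move=> low; apply/matrixP => i j; rewrite !mxE /coefp coef_sum; apply: eq_bigr => l _.
rewrite coefM big_ord_recr /= subnn big1 ?add0r ?mxE // => k _.
by have /matrixP/(_ i l) := low k (ltn_ord k); rewrite !mxE /coefp => ->; rewrite mul0r.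
Qed.

(** The leading coefficient of [P] at [t = 0] is a morphism from the central fibre to
    [(E, 0)], since the general fibre has Higgs field [t phi]. *)
Lemma degeneration_map H H0 : degenerates_to H H0 -> exists A : 'M[F]_2,
  [/\ A != 0, A *m hfield H0 = 0 & forall v u, stalk H0 v u -> stalk H v (A *m u)].
Proof.
move=> [P [Theta [k [e [e0 detP ePT fH0 S]]]]].
have exn : exists n, map_mx (coefp n) P != 0.
  apply: contrapT => no; have P0 : P = 0.
    apply/matrixP => i j; rewrite mxE; apply/polyP => n; rewrite coef0.
    have /eqP/matrixP/(_ i j) : map_mx (coefp n) P == 0.
      by apply: contrapT => /negP ne; apply: no; exists n.
    by rewrite !mxE.
  move/polyP/(_ k): detP; rewrite P0 det0 coef0 coefZ coefXn eqxx mulr1 => /esym/eqP.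
  by rewrite (negPf e0).
case: (ex_minnP exn) => n nz minn.
have low l : (l < n)%N -> map_mx (coefp l) P = 0.
  by move=> ln; apply/eqP; apply: contraTT ln => /minn; rewrite -leqNgt.
exists (map_mx (coefp n) P); split=> //.
  rewrite fH0 -coefp_mul_low // -ePT; apply/matrixP => i j; rewrite !mxE /coefp coefXM.
  case: eqP => // /eqP n0; rewrite coef_sum big1 // => l _; rewrite !mxE coefCM.
  have /low/matrixP/(_ l j) : (n.-1 < n)%N by rewrite prednK ?lt0n.
  by rewrite !mxE /coefp => ->; rewrite mulr0.
by move=> v u /S[U [-> HU]]; rewrite -coefp_mul_low.
Qed.

Lemma det2E (A : 'M[F]_2) : \det A = A 0 0 * A 1 1 - A 0 1 * A 1 0.
Proof.
rewrite (expand_det_row _ 0) sum2E /cofactor !det_mx11 !mxE /= expr0 expr1 mul1r.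
have -> : fintype.lift (0 : 'I_2) 0 = 1 by apply/eqP.
have -> : fintype.lift (1 : 'I_2) 0 = 0 by apply/eqP.
by rewrite mulN1r mulrN.
Qed.

Lemma nilpotent2 (phi : 'M[F]_2) n : phi ^+ n = 0 -> phi *m phi = 0.
Proof.
move=> nilp; have det0 : \det phi = 0.
  have detX k : \det (phi ^+ k) = \det phi ^+ k.
    by elim: k => [|k IH]; rewrite ?det1 // !exprS -IH -[_ * _]/(_ *m _) det_mulmx.
  have : \det phi ^+ n = 0 by rewrite -detX nilp det0.
  by move/eqP; rewrite expf_eq0 => /andP[_ /eqP].
pose t := phi 0 0 + phi 1 1.
have sq : phi *m phi = t *: phi.
  rewrite det2E in det0; have e : phi 0 0 * phi 1 1 = phi 0 1 * phi 1 0.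
    by apply/eqP; rewrite -subr_eq0 det0.
  apply/matrixP => i j; rewrite !mxE sum2E /t.
  by case: (ord2P i) (ord2P j) => -> [] ->; rewrite mulrDl; ring: e.
have pow k : phi ^+ k.+1 = t ^+ k *: phi.
  elim: k => [|k IH]; first by rewrite expr1 scale1r.
  by rewrite exprS IH -[_ * _]/(_ *m _) -scalemxAr sq scalerA -exprSr.
case: n nilp => [|n]; first by move/eqP; rewrite expr0 oner_eq0.
rewrite pow => /eqP; rewrite scaler_eq0 expf_eq0 => /orP[/andP[_ /eqP t0]|/eqP->].
  by rewrite sq t0 scale0r.
by rewrite mulmx0.
Qed.

Lemma matrix2_colP m (A B : 'M[F]_(m, 2)) : col 0 A = col 0 B -> col 1 A = col 1 B -> A = B.
Proof.
move=> e0 e1; apply/matrixP => i j.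
by case: (ord2P j) => ->; [have /colP/(_ i) := e0 | have /colP/(_ i) := e1]; rewrite !mxE.
Qed.

Lemma col_mulmx m n p (A : 'M[F]_(m, n)) (B : 'M[F]_(n, p)) j : col j (A *m B) = A *m col j B.
Proof. by rewrite !colE mulmxA. Qed.

(** The other clause of S-equivalence would provide an invariant line subbundle of
    degree [0]. *)
Lemma s_equivalent_stable H H' : bdeg H' = 0 -> stable_higgs H' ->
  s_equivalent H H' -> higgs_iso H H'.
Proof.
move=> d0 st [//|[L1 [a1 [L2 [a2 [d1 d2 _ [[u [r [Hu _ _ e _]]]|[u [r [Hu _ _ e _]]]]]]]]]].
  by have := st L1 u Hu (ex_intro _ a1 e); rewrite d0 d1.
by have := st L2 u Hu (ex_intro _ a2 e); rewrite d0 d2.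
Qed.

(** * Higgs bundles of type (1,1) *)
Section TypeOneOne.
Variables (L0 L1 : divisor X) (gamma : F).
Hypotheses (gamma0 : gamma != 0) (deg01 : deg L0 + deg L1 = 0) (L0_gt0 : 0 < deg L0).

Let L1_lt0 : deg L1 < 0. Proof. by move: deg01 L0_gt0; lia. Qed.

Lemma field11_mul u : (gamma *: delta_mx 1 0 : 'M_2) *m u =
  \col_i (if i == 1 then gamma * u 0 0 else 0).
Proof.
by apply/colP => i; rewrite !mxE sum2E !mxE; case: (ord2P i) => -> /=; ring.
Qed.

(** Any invariant line is the kernel of the field, which maps to [O(L1)]. *)
Lemma stable11 H : hfield H = gamma *: delta_mx 1 0 -> bdeg H = 0 ->
  (forall v u, stalk H v u -> in_stalk L1 v (u 1 0)) -> stable_higgs H.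
Proof.
move=> fH dH S1 L u HL [a]; rewrite fH field11_mul => e; rewrite dH.
have u0 : u != 0 by case: HL.
have e0 : 0 = a * u 0 0 by have /colP/(_ 0) := e; rewrite !mxE.
have e1 : gamma * u 0 0 = a * u 1 0 by have /colP/(_ 1) := e; rewrite !mxE.
have u00 : u 0 0 = 0.
  apply/eqP; apply: contraT => u00; move/eqP: e0; rewrite eq_sym mulf_eq0 (negPf u00) orbF.
  by move=> /eqP a0; move/eqP: e1; rewrite a0 mul0r mulf_eq0 (negPf gamma0) (negPf u00).
have u10 : u 1 0 != 0.
  apply: contraNneq u0 => u10; apply/eqP/colP => i; rewrite mxE.
  by case: (ord2P i) => ->.
have : deg L <= deg L1.
  apply: (deg_le_sections u10) => v f Hf.
  have /S1 : stalk H v (f *: u) by have /(line_subbundleP _ _ u0)/(_ v f)[_] := HL; apply.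
  by rewrite mxE.
by lia.
Qed.

Lemma stable_in_moduli H : bdeg H = 0 -> stable_higgs H -> in_moduli H.
Proof. by move=> d0 st; split=> // L u HL Ha; apply: ltW; exact: st HL Ha. Qed.

Section FixedPoint.
Variable H0 : higgs K.
Hypotheses (bH0 : hbundle H0 = dsum L0 L1) (fH0 : hfield H0 = gamma *: delta_mx 1 0).

Let stalkH0 v u : stalk H0 v u <-> in_stalk L0 v (u 0 0) /\ in_stalk L1 v (u 1 0).
Proof. by rewrite bH0; exact: stalk_dsum. Qed.

Let bdegH0 : bdeg H0 = 0. Proof. by rewrite bH0 bdeg_dsum. Qed.

Lemma stable_fixed : stable_higgs H0.
Proof. by apply: stable11 => // v u /stalkH0[]. Qed.

(** Rescaling [O(L0)] by [t] absorbs the factor [t] of the field. *)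
Lemma fixed11 : Cstar_fixed H0.
Proof.
split; first by apply: stable_in_moduli => //; exact: stable_fixed.
move=> t t0; left; have it0 : iota t != 0 by rewrite fmorph_eq0.
pose d : 'rV[F]_2 := \row_i (if i == 0 then iota t else 1).
have ot : ord _ (iota t) = 0 := ord_const _ t.
have eqt v L f : in_stalk L v (iota t * f) <-> in_stalk L v f.
  by rewrite /in_stalk (ord_geZ _ _ it0 (ord_const _ _)) subr0.
exists (diag_mx d); split.
- by rewrite unitmxE det_diag big_ord_recl big_ord1 !mxE /= mulr1 unitfE.
- rewrite /= fH0; apply/matrixP => i j; rewrite mul_diag_mx mul_mx_diag !mxE.
  by case: (ord2P i) (ord2P j) => -> [] -> /=; ring.
move=> v u; rewrite [stalk (scale_higgs t H0) v u]stalkH0 stalkH0 mul_diag_mx !mxE /= mul1r.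
by rewrite eqt.
Qed.

(** Shearing the lattice of [O(L0) + O(L1)] at [v0] by [h] gives the extension of
    [O(L1)] by [O(L0)] with class the principal part of [h] in
    [Hom(O(L1), O(L0))]. *)
Section Twist.
Variables (v0 : point) (h : F).

Definition shear (a : F) : 'M[F]_2 := 1%:M + a *: delta_mx 0 1.

Lemma shear_mul a u : shear a *m u = \col_i (u i 0 + (if i == 0 then a * u 1 0 else 0)).
Proof.
by apply/colP => i; rewrite !mxE sum2E !mxE; case: (ord2P i) => -> /=; ring.
Qed.

Lemma shearK a : shear a *m shear (- a) = 1%:M.
Proof.
apply/matrixP => i j; rewrite !mxE sum2E !mxE.
by case: (ord2P i) (ord2P j) => -> [] -> /=; ring.
Qed.

Lemma shear_unit a : shear a \in unitmx.
Proof. by case/mulmx1_unit: (shearK a). Qed.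

Definition twist_frame v : 'M[F]_2 :=
  (if v == v0 then shear h else 1%:M) *m dsum_frame L0 L1 v.

Lemma twist_frame_unit v : twist_frame v \in unitmx.
Proof.
by rewrite unitmx_mul dsum_frame_unit andbT; case: ifP; rewrite ?shear_unit ?unitmx1.
Qed.

Lemma twist_frame_good v : v \notin v0 :: (dom L0 ++ dom L1) -> twist_frame v = 1%:M.
Proof.
rewrite inE negb_or => /andP[/negPf vv0 good].
by rewrite /twist_frame vv0 mul1mx dsum_frame_good.
Qed.

Definition twist : bundle X := Bundle twist_frame_unit twist_frame_good.

Lemma stalk_twist v u : stalk twist v u <->
  in_stalk L0 v (u 0 0 - (if v == v0 then h * u 1 0 else 0)) /\ in_stalk L1 v (u 1 0).
Proof.
have e : invmx (twist_frame v) *m u = invmx (dsum_frame L0 L1 v) *m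
    ((if v == v0 then shear (- h) else 1%:M) *m u).
  apply: (can_inj (mulKmx (twist_frame_unit v))); rewrite mulKVmx ?twist_frame_unit //.
  rewrite /twist_frame -mulmxA mulKVmx ?dsum_frame_unit // mulmxA.
  by case: ifP; rewrite ?shearK ?mulmx1 mul1mx.
rewrite /stalk /= e -/(stalk (dsum L0 L1) v _) stalk_dsum.
case: ifP => _; first by rewrite shear_mul !mxE /= mulNr addr0.
by rewrite mul1mx subr0.
Qed.

Lemma bdeg_twist : bdeg twist = 0.
Proof.
rewrite -deg_det_div -[RHS]deg01 -degD; apply: deg_coeff => v.
rewrite coeff_det_div /= /twist_frame det_mulmx.
have -> : \det (if v == v0 then shear h else 1%:M) = 1.
  case: ifP => _; last by rewrite det1.
  rewrite -det_tr det_trig.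
    by rewrite big_ord_recl big_ord1 !mxE /= !mulr0 !addr0 mulr1.
  by apply/is_trig_mxP => i j; rewrite !mxE; case: (ord2P i) (ord2P j) => -> [] -> //=;
    rewrite mulr0 addr0.
by rewrite mul1r ord_det_dsum opprK coeffD.
Qed.

Hypotheses (h0 : h != 0) (oh : ord v0 h = coeff v0 L1 - coeff v0 L0 - 1)
  (double_zero : 2 <= ord v0 gamma + coeff v0 L1 - coeff v0 L0 + coeff v0 K).

(** In the frame sheared by [h], the field has entries [gamma h] and [gamma h^2]: the
    double zero of [gamma] compensates the square of the simple pole of [h]. *)
Let field_twist : is_higgs_field K twist (gamma *: delta_mx 1 0).
Proof.
apply/higgs_fieldP => v u f Hf /stalk_twist[S0 S1].
apply/stalk_twist; rewrite field11_mul !mxE /= mulr0 sub0r.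
have Hd : is_higgs_field K (dsum L0 L1) (gamma *: delta_mx 1 0).
  by rewrite -bH0 -fH0; exact: hfieldP.
case: eqVneq S0 => [ev|vv0] S0; last first.
  have := (higgs_fieldP _ _).1 Hd v u f Hf.
  have Hu : stalk (dsum L0 L1) v u by apply/stalk_dsum; rewrite subr0 in S0.
  move=> /(_ Hu)/stalk_dsum[_]; rewrite field11_mul !mxE /= oppr0 => S1'.
  by split=> //; left.
rewrite ev in Hf S0 S1 *; have Hu0 : ord_ge v0 (- coeff v0 L0 - 1) (u 0 0).
  rewrite -(subrK (h * u 1 0) (u 0 0)); apply: ord_geD; first by apply: ord_geW S0; lia.
  apply: (ord_geM' (_ : ord_ge v0 (coeff v0 L1 - coeff v0 L0 - 1) h) S1); last by lia.
  by right; rewrite oh.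
have Hfu : ord_ge v0 (coeff v0 K + (ord v0 gamma + (- coeff v0 L0 - 1))) (f * (gamma * u 0 0)).
  by apply: ord_geM => //; apply: ord_geM => //; right.
split; last by apply: ord_geW Hfu; move: double_zero; lia.
apply: ord_geN; apply: (ord_geM' (_ : ord_ge v0 (coeff v0 L1 - coeff v0 L0 - 1) h) Hfu).
  by right; rewrite oh.
by move: double_zero; lia.
Qed.

Definition twisted_higgs : higgs K := Higgs field_twist.

Lemma twisted_flow : upward_flow H0 twisted_higgs.
Proof.
split; first apply: stable_in_moduli; first exact: bdeg_twist.
  by apply: stable11 => //; [exact: bdeg_twist | move=> v u /stalk_twist[]].
apply: degenerates_limit; last by apply: stable_in_moduli => //; exact: stable_fixed.
apply: (@degenerates_dsum _ _ L0 L1 gamma 1%:M) => //.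
- exact: unitmx1.
- by rewrite invmx1 mul1mx mulmx1 !mxE /= mulr1.
- move=> v f; rewrite stalk_twist !mxE /= mulr1 mulr0 mulr0 if_same subr0.
  by split=> [[]|]//; split=> //; left.
move=> v f; split=> [[k /stalk_twist[_]]|Hf].
  by rewrite !mxE /= mulr0 add0r mulr1.
exists (if v == v0 then h * f else 0); apply/stalk_twist.
rewrite !mxE /= !mulr0 !mulr1 addr0 add0r; split=> //.
by case: ifP => _; rewrite subrr; left.
Qed.

(** An isomorphism commutes with the field and preserves the destabilizing [O(L0)], so
    it is a scalar; but no scalar identifies the two lattices at [v0]. *)
Lemma twisted_not_iso : ~ higgs_iso twisted_higgs H0.
Proof.
move=> [G [uG comm iso]]; rewrite /= fH0 in comm.
have G01 : G 0 1 = 0.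
  have /matrixP/(_ 0 0) := comm; rewrite !mxE !sum2E !mxE /=.
  rewrite !mulr0 !mul0r !mulr1 !add0r => /eqP.
  by rewrite mulf_eq0 (negPf gamma0) orbF => /eqP.
have G0011 : G 1 1 = G 0 0.
  have /matrixP/(_ 1 0) := comm; rewrite !mxE !sum2E !mxE /=.
  rewrite !mulr0 !mul0r !mulr1 !add0r addr0 => e; apply: (mulIf gamma0).
  by rewrite e mulrC.
have G00 : G 0 0 != 0.
  apply/eqP => G00; move: uG; rewrite unitmxE unitfE det_trig.
    by rewrite big_ord_recl big_ord1 G00 mul0r eqxx.
  by apply/is_trig_mxP => i j; case: (ord2P i) (ord2P j) => -> [] -> //=; rewrite G01.
have isoE v u : stalk twist v u <-> in_stalk L0 v (G 0 0 * u 0 0) /\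
    in_stalk L1 v (G 1 0 * u 0 0 + G 0 0 * u 1 0).
  rewrite -[stalk twist v u]/(stalk twisted_higgs v u) iso stalkH0 !mxE !sum2E.
  by rewrite G01 G0011 mul0r addr0.
have G10 : G 1 0 = 0.
  apply/eqP; apply: contraT => G10; suff : deg L0 <= deg L1 by move: L1_lt0 L0_gt0; lia.
  apply: (deg_le_sections G10) => v f Hf.
  have /isoE[_] : stalk twist v (f *: delta_mx 0 0).
    by apply/stalk_twist; rewrite !mxE /= mulr1 !mulr0 if_same subr0; split=> //; left.
  by rewrite !mxE /= mulr1 !mulr0 addr0 mulrC.
pose t k := uniformizer v0 ^ k.
have t0 k : t k != 0 := uniformizerXz_neq0 v0 k.
have ot k : ord v0 (t k) = k := ord_uniformizerXz v0 k.
have oG00 : ord v0 (G 0 0) <= 0.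
  pose x := (G 0 0)^-1 * t (- coeff v0 L0).
  have x0 : x != 0 by rewrite mulf_neq0 ?invr_eq0.
  have /stalk_twist[+ _] : stalk twist v0 (x *: delta_mx 0 0).
    apply/isoE; rewrite !mxE /= mulr1 !mulr0 addr0 G10 mul0r; split; last by left.
    by rewrite /x mulrA mulfV // mul1r; right; rewrite ot.
  rewrite !mxE /= !mulr0 if_same mulr1 subr0 => /(ord_geN0 x0).
  by rewrite /x ordM ?invr_eq0 // ordV ot; lia.
have /isoE[+ _] : stalk twist v0 (t (- coeff v0 L1) *: (h *: delta_mx 0 0 + delta_mx 1 0)).
  apply/stalk_twist; rewrite !mxE /= eqxx mulr0 mulr1 addr0 add0r mulr1; split.
    by left; rewrite mulrC subrr.
  by right; rewrite ot.
rewrite !mxE /= mulr1 addr0 => /ord_geN0; rewrite !mulf_neq0 // => /(_ isT).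
by rewrite !ordM ?mulf_neq0 // ot oh; move: oG00; lia.
Qed.

End Twist.

Lemma nilpotent11 : nilpotent_field (gamma *: delta_mx 1 0 : 'M[F]_2).
Proof.
exists 2%N; rewrite expr2 -[_ * _]/(_ *m _) -scalemxAl -scalemxAr mul_delta_mx_0 //.
by rewrite !scaler0.
Qed.

(** At a multiple zero of the field [O(L0) -> O(L1) K], the gluing can be twisted
    by a simple pole without making the field irregular. *)
Lemma wobbly11 v0 :
  2 <= ord v0 gamma + coeff v0 L1 - coeff v0 L0 + coeff v0 K -> wobbly H0.
Proof.
move=> double_zero; split; first exact: fixed11.
pose h := uniformizer v0 ^ (coeff v0 L1 - coeff v0 L0 - 1).
have h0 : h != 0 := uniformizerXz_neq0 v0 _.
have oh : ord v0 h = coeff v0 L1 - coeff v0 L0 - 1 := ord_uniformizerXz v0 _.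
move=> /(_ _ (twisted_flow h0 oh double_zero) nilpotent11) eqv.
case: (twisted_not_iso (h0 := h0) (oh := oh) (double_zero := double_zero)).
by apply: s_equivalent_stable eqv => //; exact: stable_fixed.
Qed.

(** The degeneration gives a map [u] from [O(L0)] to a nilpotent [H] in the upward flow.
    As [gamma] has no zero, [u] and [gamma^-1 phi u] map [O(L0) + O(L1)] to [H]
    compatibly with the fields, and both bundles have degree [0]. *)
Lemma very_stable11 :
  (forall v, ord v gamma + coeff v L1 - coeff v L0 + coeff v K = 0) -> very_stable H0.
Proof.
move=> nowhere0; split; first exact: fixed11.
move=> H [[dH ssH] [H1 [degH1 _ /s_equivalent_stable iso1]]] [n nilp].
have [G [uG comm iso]] := iso1 bdegH0 stable_fixed.
have [B [B0 Bphi BS]] := degeneration_map degH1.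
pose A := B *m invmx G.
have A0 : A != 0 by apply: contraNneq B0 => e; rewrite -(mulmxKV uG B) -/A e mul0mx.
have Aphi : A *m delta_mx 1 0 = 0 :> 'M_2.
  have e : A *m hfield H0 = 0.
    rewrite -[hfield H0](mulmxK uG) -comm /A !mulmxA mulmxKV // Bphi mul0mx //.
  by apply: (scalerI gamma0); rewrite scaler0 -e fH0 scalemxAr.
have AS v u : stalk H0 v u -> stalk H v (A *m u).
  move=> Hu; rewrite /A -mulmxA; apply: BS; apply/iso.
  by rewrite mulKVmx.
have col1A : col 1 A = 0.
  apply/colP => i; have /matrixP/(_ i 0) := Aphi; rewrite !mxE sum2E !mxE /=.
  by rewrite mulr0 add0r mulr1.
set u := col 0 A; have u0 : u != 0.
  by apply: contraNneq A0 => e; apply/eqP/matrix2_colP; rewrite col0.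
have uS v f : in_stalk L0 v f -> stalk H v (f *: u).
  move=> Hf; have /AS : stalk H0 v (f *: delta_mx 0 0).
    by apply/stalkH0; rewrite !mxE /= mulr1 mulr0; split=> //; left.
  by rewrite -scalemxAr -colE.
set phi := hfield H in nilp *.
(* Otherwise the saturation of the image of O(L0) is invariant, of positive degree. *)
have u_noninv a : phi *m u <> a *: u.
  move=> inv; have [L HL] := saturation H u0.
  have := ssH L u HL (ex_intro _ a inv); rewrite dH.
  suff : deg L0 <= deg L by move: L0_gt0; lia.
  apply: (@deg_le_sections _ _ _ _ 1); first exact: oner_neq0.
  by move=> v f /uS/((line_subbundleP _ _ u0).1 HL); rewrite mulr1.
have phi2 : phi *m phi = 0 by exact: nilpotent2 nilp.
pose w := gamma^-1 *: (phi *m u).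
have wS v f : in_stalk L1 v f -> stalk H v (f *: w).
  move=> Hf; pose k := uniformizer v ^ coeff v K.
  have -> : f *: w = k *: (phi *m ((f * gamma^-1 * k^-1) *: u)).
    rewrite /w -scalemxAr !scalerA; congr (_ *: _); rewrite mulrCA mulfV ?mulr1 //.
    exact: uniformizerXz_neq0.
  apply: (higgs_fieldP _ _).1 => //; first exact: hfieldP.
    exact: ord_ge_uniformizerXz.
  apply: uS; have Hg : ord_ge v (- ord v gamma) gamma^-1 by right; rewrite ordV.
  have Hk : ord_ge v (- coeff v K) k^-1 by right; rewrite ordV ord_uniformizerXz.
  have := ord_geM (ord_geM Hf Hg) Hk; apply: ord_geW.
  by have := nowhere0 v; lia.
pose Q : 'M[F]_2 := \matrix_(i, j) if j == 0 then u i 0 else w i 0.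
have Q0 : col 0 Q = u by apply/colP => i; rewrite !mxE.
have Q1 : col 1 Q = w by apply/colP => i; rewrite !mxE.
have QE i j : Q i j = if j == 0 then u i 0 else w i 0 by rewrite [LHS]mxE.
have uQ : Q \in unitmx.
  rewrite unitmxE unitfE det2E !QE /= subr_eq0; apply/eqP => dep.
  have [i ui] : exists i, u i 0 != 0 by apply/cV0Pn.
  apply: (u_noninv (gamma * (w i 0 / u i 0))).
  have -> : phi *m u = gamma *: w by rewrite scalerA mulfV // scale1r.
  rewrite -scalerA; congr (_ *: _); apply/colP => j; rewrite [RHS]mxE.
  apply: (mulIf ui); rewrite mulrAC divfK //.
  by case: (ord2P i) (ord2P j) => -> [] -> //; rewrite [w 1 0 * _]mulrC dep.
have phiQ : phi *m Q = Q *m hfield H0.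
  apply: matrix2_colP; rewrite !col_mulmx ?Q0 ?Q1 fH0 [RHS]mulmx_col2 Q0 Q1
    ![col _ (_ *: _) _ _]mxE ![(_ *: _ : 'M_2) _ _]mxE ![delta_mx _ _ _ _]mxE /=.
    by rewrite mulr0 mulr1 scale0r add0r scalerA mulfV // scale1r.
  by rewrite !mulr0 !scale0r addr0 /w -scalemxAr mulmxA phi2 mul0mx scaler0.
left; exists (invmx Q); split.
- by rewrite unitmx_inv.
- by rewrite -[hfield H](mulmxK uQ) -/phi phiQ -mulmxA mulKmx.
move=> v x; rewrite bH0 -(stalk_two_sections (E := H) uQ) ?Q0 ?Q1 ?deg01 ?dH ?mulKVmx //.
Qed.

End FixedPoint.
End TypeOneOne.
End HiggsBundles.

(** * The exact sequence of a point of the locus *)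

Section Spectral.
Context (R : realType) (X : curve R) (K T M : divisor X) (theta a b : fun_field X).
Local Notation C := R[i].
Local Notation F := (fun_field X).
Local Notation iota := (const X).
Local Notation point := (Defs.point X).
Implicit Types (f h : F) (v : point) (L D : divisor X) (u : 'cV[F]_2) (i : 'I_2).
Hypotheses (hT : is_2torsion T theta) (hc : in_BTni K T theta a b).

Let theta0 : theta != 0. Proof. by case: hT => _ []. Qed.

Let ord_theta v : ord v theta = coeff v T + coeff v T.
Proof.
case: hT => _ [_ /(_ v)]; rewrite /zero_div coeffN coeffD coeff0; lia.
Qed.

Lemma deg_torsion : deg T = 0.
Proof.
have : deg (T + T) <= 0 by apply: (deg_le0 theta0) => v; rewrite coeffD ord_theta.
have : deg (- (T + T)) <= 0.
  apply: (@deg_le0 _ _ theta^-1); first by rewrite invr_eq0.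
  by move=> v; rewrite ordV coeffN coeffD ord_theta.
by rewrite degN degD; lia.
Qed.

Lemma spectral_b_neq0 : b != 0.
Proof.
case: hc => _ _ [_ irr] _; apply/eqP => b0.
have /irr : 'X - a%:P %| char_eq (base_point theta a b).
  apply/dvdpP; exists ('X - a%:P); rewrite /char_eq /= b0 expr0n mulr0 subr0.
  by rewrite -mul_polyC !polyCM polyC_natr; ring.
rewrite size_XsubC => /(_ isT)/eqp_size; rewrite size_XsubC /char_eq.
rewrite -addrA size_polyDl ?size_polyXn //.
rewrite ltnS; apply: leq_trans (size_polyD _ _) _; rewrite geq_max.
rewrite size_polyN (leq_trans (size_scale_leq _ _)) ?size_polyX //.
by rewrite (leq_trans (size_polyC_leq1 _)).
Qed.

Local Notation B v := (div_b K T b v).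

Lemma div_b_ge0 v : 0 <= B v.
Proof.
case: hc => _ /(_ v)/(ord_geN0 spectral_b_neq0) + _ _.
by rewrite /div_b /zero_div; lia.
Qed.

(** A double zero of [b] would be a singularity of the spectral curve worse than
    a node. *)
Lemma div_b_le1 v : B v <= 1.
Proof.
case: hc => Sa _ _ nodal; rewrite leNgt; apply/negP => gt1.
have [z oz] := ord_surj v.
have z0 : z != 0 by apply: contra_eq_neq oz => ->; rewrite Defs.ord0.
have ozX k : ord v (z ^ k) = k by rewrite ordXz oz mulr1.
have zX0 k : z ^ k != 0 by rewrite expfz_neq0.
set y := z ^ coeff v K; have yy : z ^ (2 * coeff v K) = y * y.
  by rewrite -expfzDr //; congr (_ ^ _); lia.
have [l Hl] : exists l : C, ord_ge v 1 (a * y - iota l).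
  apply: residue; apply: (ord_geM' (Sa v) (_ : ord_ge v (coeff v K) y)); last by rewrite addNr.
  by right; rewrite ozX.
have o4 : ord v (4 : F) = 0 by rewrite -(rmorph_nat iota) ord_const.
have o2 : ord_ge v 0 (2 : F) by rewrite -(rmorph_nat iota); exact: ord_ge_iota.
pose e := theta * b ^+ 2 * (y * y).
have oe : ord v e = B v + B v.
  have b0 := spectral_b_neq0; have y0 : y != 0 by exact: zX0.
  rewrite /e !ordM ?mulf_neq0 ?expf_neq0 // ord_theta !ozX /div_b /zero_div coeffD.
  lia.
apply: (nodal v z l oz); rewrite /= ?yy -/y.
- rewrite (_ : _ - _ = - (2 * (a * y - iota l))); last by ring.
  by apply: ord_geN; apply: (ord_geM' o2 Hl).
- rewrite (_ : _ + _ = (a * y - iota l) * (a * y - iota l) - e); last by rewrite /e; ring.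
  apply: ord_geB; first exact: (ord_geM' Hl Hl).
  by right; rewrite oe; move: gt1; lia.
rewrite (_ : _ - _ = 4 * e); last by rewrite /e; ring.
apply: (ord_geM' (_ : ord_ge v 0 4) (_ : ord_ge v (B v + B v) e)).
- by right; rewrite o4.
- by right; rewrite oe.
- by move: gt1; lia.
Qed.

Local Notation S := (summand T M).

(** The roles of [M] and [MT] are symmetric: an index [i] selects one of them, and
    [other i] the remaining one. *)
Definition other (i : 'I_2) : 'I_2 := if i == 0 then 1 else 0.

Definition off_diagonal i : F := Phi theta a b (other i) i.

Lemma off_diagonal_neq0 i : off_diagonal i != 0.
Proof.
have b0 := spectral_b_neq0.
by rewrite /off_diagonal mxE; case: (ord2P i) => -> //=; rewrite mulf_neq0.
Qed.

(** Both off-diagonal entries of [Phi] are multiplication by [b], hence vanish exactly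
    on [div b], up to the identification of [T^2] with [O_X]. *)
Lemma ord_off_diagonal v i :
  ord v (off_diagonal i) = B v - coeff v (S (other i)) + coeff v (S i) - coeff v K.
Proof.
have b0 := spectral_b_neq0; rewrite /off_diagonal mxE /div_b /zero_div /summand.
case: (ord2P i) => -> /=; rewrite ?ordM // ?ord_theta !coeffD; lia.
Qed.

Lemma deg_summand i : deg (S i) = deg M.
Proof. by rewrite /summand; case: ifP; rewrite // degD deg_torsion addr0. Qed.

Section Sequence.
Variables (H : higgs K) (Psi : 'M[F]_2).
Hypothesis hPsi : spectral_sequence T theta a b M H Psi.

Definition direction i : 'cV[F]_2 := invmx Psi *m incl X i.
Local Notation U := direction.

Let uPsi : Psi \in unitmx. Proof. by case: hPsi. Qed.

Lemma direction_neq0 i : U i != 0.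
Proof.
apply/eqP => e; have : incl X i = 0 by rewrite -(mulKVmx uPsi (incl X i)) -/(U i) e mulmx0.
by move/colP/(_ i); rewrite !mxE !eqxx => /eqP; rewrite oner_eq0.
Qed.

(** The cokernel map is given by two functions [rho 0] and [rho 1], one of which
    generates its stalk. *)
Lemma stalk_directions v : exists rho : 'I_2 -> F,
  [/\ forall i, ord_ge v (coeff v (S i)) (rho i),
      exists i, rho i != 0 /\ ord v (rho i) = coeff v (S i)
    & forall i f h, stalk H v (f *: U i + h *: U (other i)) <->
        [/\ in_stalk (S i) v f, in_stalk (S (other i)) v h
          & ord_ge v (B v) (rho i * f + rho (other i) * h)]].
Proof.
case: hPsi => _ _ /(_ v)[r [[r_ge [k [i [ri0 ori]]]] Hr]].
have t0 := uniformizerXz_neq0 v; have ot := ord_uniformizerXz v.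
have rE j j' : (r *m frame (dsum M (M + T)) v) j j' = uniformizer v ^ (- coeff v (S j')) * r 0 j'.
  by rewrite mul_mx_diag !mxE (ord1 j) mulrC.
exists (fun i => r 0 i); split.
- move=> j; have := r_ge 0 j; rewrite rE.
  by move/(ord_geZ _ _ (t0 _) (ot _)); rewrite sub0r opprK.
- exists i; move: ri0 ori; rewrite rE mulf_eq0 negb_or t0 /= => ri0.
  by rewrite ordM // ot; split=> //; lia.
move=> j f h; rewrite Hr mulmxDr -!scalemxAr !mulKVmx // stalk_dsum.
have r1 (x : 'cV[F]_2) : mx_ord_ge v (B v) (r *m x) <->
    ord_ge v (B v) (r 0 0 * x 0 0 + r 0 1 * x 1 0).
  split=> [/(_ 0 0)|Hx k1 k2]; first by rewrite mxE sum2E.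
  by rewrite (ord1 k1) (ord1 k2) mxE sum2E.
rewrite r1 !mxE; case: (ord2P j) => -> /=; rewrite !mulr1 !mulr0 ?addr0 ?add0r.
  by split=> [[[]]|[]].
by rewrite [X in ord_ge _ _ X]addrC; split=> [[[]]|[]].
Qed.

Local Notation defect := (defect_at T M H Psi).

(** At a point of [div b], which is reduced, the [i]-th coordinate of the cokernel map
    is either a generator or zero; in the second case the other coordinate is a
    generator. *)
Lemma defectP v i : exists rho : 'I_2 -> F,
  [/\ forall f h, stalk H v (f *: U i + h *: U (other i)) <->
        [/\ in_stalk (S i) v f, in_stalk (S (other i)) v h
          & ord_ge v (B v) (rho i * f + rho (other i) * h)],
      forall j, ord_ge v (coeff v (S j)) (rho j),
      defect i v -> [/\ rho i != 0, ord v (rho i) = coeff v (S i) & B v = 1]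
    & ~ defect i v -> ord_ge v (coeff v (S i) + B v) (rho i) /\
        (B v = 1 -> rho (other i) != 0 /\ ord v (rho (other i)) = coeff v (S (other i)))].
Proof.
have [rho [rho_ge [k [rk0 ork]] HS]] := stalk_directions v.
have SU f : stalk H v (f *: U i) <-> in_stalk (S i) v f /\ ord_ge v (B v) (rho i * f).
  have := HS i f 0; rewrite scale0r addr0 mulr0 addr0 => ->.
  by split=> [[]|[]] //; split=> //; left.
exists rho; split=> //.
  move=> [f [Sf nSf]].
  have Hf : ord_ge v 0 (rho i * f) by apply: (ord_geM' (rho_ge i) Sf); rewrite subrr.
  have B1 : B v = 1.
    have := div_b_le1 v; have := div_b_ge0 v; have [B0|] := eqVneq (B v) 0; last by lia.
    by case: nSf; apply/SU; rewrite B0.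
  have r0 : rho i != 0 by apply/eqP => e; apply: nSf; apply/SU; rewrite e mul0r; split=> //; left.
  split=> //; have := ord_geN0 r0 (rho_ge i).
  have [//|ne ge] := eqVneq (ord v (rho i)) (coeff v (S i)).
  exfalso; apply: nSf; apply/SU; split=> //; rewrite B1.
  have Hr : ord_ge v (coeff v (S i) + 1) (rho i) by right; lia.
  by apply: (ord_geM' Hr Sf); rewrite addrAC subrr.
move=> nd; have Hi : ord_ge v (coeff v (S i) + B v) (rho i).
  pose t := uniformizer v ^ (- coeff v (S i)).
  have /SU[_] : stalk H v (t *: U i).
    apply: contrapT => nS; apply: nd; exists t; split=> //; exact: ord_ge_uniformizerXz.
  rewrite mulrC => /(ord_geZ _ _ (uniformizerXz_neq0 _ _) (ord_uniformizerXz _ _)).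
  by rewrite opprK addrC.
split=> // B1; have ki : k != i.
  apply/eqP => ki; rewrite ki in rk0 ork.
  by have := ord_geN0 rk0 Hi; rewrite ork B1; lia.
suff <- : k = other i by [].
by move: ki; rewrite /other; case: (ord2P k) (ord2P i) => -> [] ->.
Qed.

Definition defect_div D i := forall v, coeff v D = (`[< defect i v >] : nat)%:Z.

Lemma defect_saturated D i : defect_div D i -> line_subbundle H (S i - D) (U i).
Proof.
move=> HD; apply/line_subbundleP; first exact: direction_neq0.
move=> v f; have [rho [HS rho_ge dy dn]] := defectP v i.
have -> : stalk H v (f *: U i) <-> in_stalk (S i) v f /\ ord_ge v (B v) (rho i * f).
  have := HS f 0; rewrite scale0r addr0 mulr0 addr0 => ->.
  by split=> [[]|[]] //; split=> //; left.
rewrite /in_stalk coeffB HD; case: (asboolP (defect i v)) => [/dy[r0 or B1]|/dn[Hr _]].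
  rewrite B1 (ord_geZ _ _ r0 or); split=> [[_]|]; first by apply: ord_geW; lia.
  by move=> Hf; split; apply: ord_geW Hf; lia.
rewrite subr0; split=> [[]//|Hf]; split=> //.
by apply: (ord_geM' Hr Hf); lia.
Qed.

Lemma saturated_defect D i : (forall v, 0 <= coeff v D <= B v) ->
  line_subbundle H (S i - D) (U i) -> defect_div D i.
Proof.
move=> DB /(line_subbundleP _ _ (direction_neq0 i)) HU v.
have := DB v; have := div_b_le1 v; case: (asboolP (defect i v)) => [[f [Sf nf]]|nd] B1 D01.
  have [D0|] := eqVneq (coeff v D) 0; last by move: B1 D01; lia.
  by case: nf; apply/HU; rewrite /in_stalk coeffB D0 subr0.
have [//|D0] := eqVneq (coeff v D) 0; exfalso; apply: nd.
exists (uniformizer v ^ (- coeff v (S i))); split; first exact: ord_ge_uniformizerXz.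
move/HU; rewrite /in_stalk coeffB => /(ord_geN0 (uniformizerXz_neq0 _ _)).
by rewrite ord_uniformizerXz; move: D01 D0; lia.
Qed.

(** At a defect, the [i]-th coordinate of the cokernel map can be used to correct any
    element of the other summand; at the remaining points of [div b], the condition
    bears on the other summand alone. *)
Lemma defect_quotient D i v h : defect_div D i ->
  (exists f, stalk H v (f *: U i + h *: U (other i))) <->
  ord_ge v (B v - coeff v D - coeff v (S (other i))) h.
Proof.
move=> HD; have [rho [HS rho_ge dy dn]] := defectP v i.
have -> : (exists f, stalk H v (f *: U i + h *: U (other i))) <->
  exists f, [/\ in_stalk (S i) v f, in_stalk (S (other i)) v h
          & ord_ge v (B v) (rho i * f + rho (other i) * h)].
  by split=> -[f /HS ?]; exists f => //; apply/HS.
rewrite HD; case: (asboolP (defect i v)) => [/dy[r0 or B1]|/dn[Hr Hr']].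
  rewrite B1 subrr sub0r; split=> [[f []]//|Hh].
  exists (- (rho i)^-1 * (rho (other i) * h)); split=> //.
    have Hi : ord_ge v (- coeff v (S i)) (- (rho i)^-1) by apply: ord_geN; right; rewrite ordV or.
    apply: (ord_geM' Hi (ord_geM (rho_ge (other i)) Hh)); lia.
  by rewrite mulrA mulrN mulfV // mulN1r addNr; left.
rewrite subr0; have [B0|B0] := eqVneq (B v) 0.
  rewrite B0 sub0r; split=> [[f []]//|Hh]; exists 0; split=> //; first by left.
  by rewrite mulr0 add0r; apply: (ord_geM' (rho_ge (other i)) Hh); rewrite subrr.
have B1 : B v = 1 by have := div_b_le1 v; have := div_b_ge0 v; lia.
have [r0 or] := Hr' B1; rewrite B1 in Hr *.
split=> [[f [Sf Sh Hsum]]|Hh].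
  apply/(ord_geZ _ _ r0 or).
  rewrite -(addKr (rho i * f) (rho (other i) * h)); apply: ord_geD => //.
  by apply: ord_geN; apply: (ord_geM' Hr Sf); lia.
exists 0; split; [by left | by apply: ord_geW Hh; lia |].
by rewrite mulr0 add0r; apply/(ord_geZ _ _ r0 or).
Qed.

(** A line subbundle along another direction has degree at most
    [- deg (S i - D) < 0]. *)
Lemma max_destabilizing_saturated D i : bdeg H = 0 -> deg D < deg M ->
  line_subbundle H (S i - D) (U i) -> max_destabilizing H (S i - D) (U i).
Proof.
move=> dH ltD HU; have U0 := direction_neq0 i.
have dSD : deg (S i - D) = deg M - deg D by rewrite degB deg_summand.
split=> //; first by rewrite dH dSD; lia.
move=> L u Hu; have [u0 _] := Hu.
pose Q : 'M[F]_2 := \matrix_(j, k) if k == 0 then U i j 0 else u j 0.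
have QE j k : Q j k = if k == 0 then U i j 0 else u j 0 by rewrite [LHS]mxE.
have [uQ|nQ] := boolP (Q \in unitmx).
  have : deg (S i - D) + deg L <= bdeg H.
    apply: (deg_independent uQ).
      by rewrite (_ : col 0 Q = U i) //; apply/colP => j; rewrite mxE QE.
    by rewrite (_ : col 1 Q = u) //; apply/colP => j; rewrite mxE QE.
  by rewrite dH dSD; lia.
move: nQ; rewrite unitmxE unitfE negbK det2E !QE /= subr_eq0 => /eqP dep.
have [j Uj] : exists j, U i j 0 != 0 by apply/cV0Pn.
have uE : u = (u j 0 / U i j 0) *: U i.
  apply/colP => k; rewrite [RHS]mxE; apply: (mulIf Uj); rewrite mulrAC divfK //.
  by case: (ord2P j) (ord2P k) => -> [] -> //; rewrite [u 1 0 * _]mulrC dep.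
apply: (@deg_le_sections _ _ _ _ (u j 0 / U i j 0)).
  by apply: contraNneq u0 => e; rewrite uE e scale0r.
move=> v f Hf; apply/((line_subbundleP _ _ U0).1 HU).
by rewrite -scalerA -uE; apply/((line_subbundleP _ _ u0).1 Hu).
Qed.

(** The quotient [S'(-div b + D)] is identified with [S K^-1 (D)] by the off-diagonal
    entry of [Phi], with divisor [div b].  The factor [s^2] is a unit: it only
    normalizes the generator of the quotient so that the field becomes [s^2]. *)
Lemma directions_degenerate D s i (H0 : higgs K) : defect_div D i ->
  s != 0 -> (forall v, ord v s = 0) ->
  hbundle H0 = dsum (S i - D) (S i - K + D) -> hfield H0 = s ^+ 2 *: delta_mx 1 0 ->
  degenerates_to H H0.
Proof.
move=> HD s0 os bH0 fH0; have s20 : s ^+ 2 != 0 by rewrite expf_neq0.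
set c := off_diagonal i / s ^+ 2.
have c0 : c != 0 by rewrite mulf_neq0 ?invr_eq0 ?off_diagonal_neq0.
have oc v : ord v c = B v - coeff v (S (other i)) + coeff v (S i) - coeff v K.
  by rewrite ordM ?invr_eq0 ?off_diagonal_neq0 // ordV ordXn os ord_off_diagonal; lia.
pose N : 'M[F]_2 := \matrix_(j, k) if k == 0 then (j == i)%:R else c * (j == other i)%:R.
have NE j k : N j k = if k == 0 then (j == i)%:R else c * (j == other i)%:R by rewrite [LHS]mxE.
have uN : N \in unitmx.
  rewrite unitmxE unitfE det2E !NE /=; case: (ord2P i) => -> /=.
    by rewrite mulr1 mul1r mulr0 subr0.
  by rewrite mul0r mulr1 sub0r oppr_eq0 mulr1.
pose Q := invmx Psi *m N.
have N0 : col 0 N = incl X i by apply/colP => j; rewrite [LHS]mxE NE mxE eqxx andbT.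
have N1 : col 1 N = c *: incl X (other i) by apply/colP => j; rewrite [LHS]mxE NE !mxE eqxx andbT.
have Q0 : col 0 Q = U i by rewrite col_mulmx N0.
have Q1 : col 1 Q = c *: U (other i) by rewrite col_mulmx N1 -scalemxAr.
have uQ : Q \in unitmx by rewrite unitmx_mul unitmx_inv uPsi.
have phiU : hfield H *m U i = a *: col 0 Q + s ^+ 2 *: col 1 Q.
  have [_ comm _] := hPsi.
  rewrite Q0 Q1 -(mulKmx uPsi (hfield H *m U i)) (mulmxA Psi) comm -mulmxA (mulKVmx uPsi).
  rewrite scalerA /c mulrCA mulfV // mulr1 !scalemxAr -mulmxDr; congr (_ *m _).
  apply/colP => j; rewrite /off_diagonal !mxE sum2E !mxE.
  by case: (ord2P i) (ord2P j) => -> [] -> /=; ring.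
apply: (degenerates_dsum uQ bH0 fH0).
- transitivity ((invmx Q *m (hfield H *m col 0 Q)) 1 0).
    by rewrite -!col_mulmx [RHS]mxE mulmxA.
  rewrite {1}Q0 phiU; pose w : 'cV[F]_2 := \col_j if j == 0 then a else s ^+ 2.
  have -> : a *: col 0 Q + s ^+ 2 *: col 1 Q = Q *m w by rewrite mulmx_col2 !mxE.
  by rewrite mulKmx // mxE.
- move=> v f; rewrite Q0; have HU := defect_saturated HD.
  exact: ((line_subbundleP _ _ (direction_neq0 i)).1 HU).
move=> v f; rewrite Q0 Q1 scalerA.
rewrite (_ : (exists h, _) <-> _); last exact: (defect_quotient v (f * c) HD).
rewrite mulrC (ord_geZ _ _ c0 (oc v)) /in_stalk coeffD coeffB.
rewrite (_ : _ - _ = - (coeff v (S i) - coeff v K + coeff v D)) //; ring.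
Qed.

(** The nilpotent field is the other off-diagonal corner of [Phi]: as [b] vanishes
    on [div b], it maps [M + MT] into [H K]. *)
Lemma nilpotent_higgs_ex : exists psi, [/\ psi != 0, is_higgs_field K H psi & nilpotent_field psi].
Proof.
pose e : 'M[F]_2 := off_diagonal 1 *: delta_mx 0 1.
have b1 := off_diagonal_neq0 1.
exists (invmx Psi *m e *m Psi); split.
- apply/eqP => z; have /matrixP/(_ 0 1) : e = 0.
    by rewrite -(mulKVmx uPsi e) -(mulmxK uPsi (invmx Psi *m e)) z mul0mx mulmx0.
  by rewrite !mxE /= mulr1 => /eqP; rewrite (negPf b1).
- apply/higgs_fieldP => v u f Hf.
  have [rho [rho_ge _ HS]] := stalk_directions v.
  pose x := Psi *m u; have uE : u = x 0 0 *: U 0 + x 1 0 *: U (other 0).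
    rewrite -[LHS](mulKmx uPsi u) -/x !scalemxAr -mulmxDr; congr (_ *m _).
    by move: (x) => y; apply/colP => j; rewrite !mxE; case: (ord2P j) => -> /=;
      rewrite !(mulr1, mulr0) ?addr0 ?add0r.
  rewrite {1}uE => /HS[_ Sx1 _].
  have -> : f *: (invmx Psi *m e *m Psi *m u) =
      (f * off_diagonal 1 * x 1 0) *: U 0 + 0 *: U (other 0).
    rewrite scale0r addr0 -!mulmxA -/x [LHS]scalemxAr [RHS]scalemxAr; congr (_ *m _).
    rewrite /e; move: (x) (off_diagonal 1) => y o.
    by apply/colP => j; rewrite !mxE sum2E !mxE; case: (ord2P j) => -> /=; ring.
  apply/HS; rewrite mulr0 addr0.
  have Hb : ord_ge v (ord v (off_diagonal 1)) (off_diagonal 1) by right.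
  have Hfx : ord_ge v (B v - coeff v (S 0)) (f * off_diagonal 1 * x 1 0).
    apply: (ord_geM' (ord_geM Hf Hb) Sx1); rewrite ord_off_diagonal.
    rewrite (erefl : other 0 = 1) (erefl : other 1 = 0).
    by rewrite le_eqVlt; apply/orP; left; apply/eqP; ring.
  split; [|by left|].
    by apply: ord_geW Hfx; have := div_b_ge0 v; lia.
  by apply: (ord_geM' (rho_ge 0) Hfx); rewrite addrC subrK.
have ee : e *m e = 0.
  by rewrite /e -scalemxAl -scalemxAr mul_delta_mx_0 // !scaler0.
exists 2%N; rewrite expr2 -[_ * _]/(_ *m _) -!mulmxA (mulKVmx uPsi).
by rewrite (mulmxA e) ee mul0mx mulmx0.
Qed.

End Sequence.
End Spectral.

(** * The three cases *)

Section Limits.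
Context (R : realType) (X : curve R) (K : divisor X).
Local Notation C := R[i].
Local Notation F := (fun_field X).
Local Notation point := (Defs.point X).
Implicit Types (f h : F) (v : point) (L D : divisor X) (u : 'cV[F]_2).
Implicit Types (H : higgs K).

Lemma dsum_higgs_field L0 L1 gamma :
  (forall v, 0 <= ord v gamma + coeff v L1 - coeff v L0 + coeff v K) ->
  is_higgs_field K (dsum L0 L1) (gamma *: delta_mx 1 0).
Proof.
move=> Hg; apply/higgs_fieldP => v u f Hf /stalk_dsum[S0 _]; apply/stalk_dsum.
rewrite field11_mul !mxE /= mulr0; split; first by left.
have Hgamma : ord_ge v (ord v gamma) gamma by right.
by apply: (ord_geM' Hf (ord_geM Hgamma S0)); have := Hg v; lia.
Qed.

(** The constant family extends, with Higgs field [t phi]. *)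
Lemma semistable_limit H : bdeg H = 0 -> semistable_bundle H -> is_limit H (zero_higgs K H).
Proof.
move=> dH ssH; apply: degenerates_limit; last by split=> // L u HL _; exact: ssH HL.
exists 1%:M, ('X *: map_mx polyC (hfield H)), 0%N, 1; rewrite oner_neq0 det1 expr0 scale1r.
split=> //; first by rewrite mulmx1 mul1mx.
  by apply/matrixP => i j; rewrite !mxE /coefp coefXM.
move=> v u0; split=> [Hu|[u [-> /(_ 0%N)]]]; last by rewrite mul1mx.
exists (map_mx polyC u0); split.
  by apply/colP => i; rewrite !mxE /coefp coefC.
move=> [|n]; rewrite mul1mx.
  by rewrite (_ : map_mx _ _ = u0) //; apply/colP => i; rewrite !mxE /coefp coefC.
rewrite (_ : map_mx _ _ = 0); first exact: stalk0.
by apply/colP => i; rewrite !mxE /coefp coefC.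
Qed.

End Limits.

Section MainParts.
Context (R : realType) (X : curve R) (g : nat) (K T M : divisor X) (theta a b : fun_field X).
Hypotheses (hg : (1 < g)%N) (hK : has_genus g K) (hT : is_2torsion T theta)
  (hM : deg M = g%:Z - 1) (hc : in_BTni K T theta a b).
Variable H : higgs K.
Hypothesis hH : in_SMT T theta a b M H.
Local Notation F := (fun_field X).
Implicit Types (D : divisor X) (s : F) (i : 'I_2).

Local Notation S := (summand T M).

Let dH : bdeg H = 0. Proof. by case: hH => -[]. Qed.

Lemma defect_destabilized i D : deg D < g%:Z - 1 ->
  has_defect T theta a b M H i D -> destabilized_by T theta a b M H i D.
Proof.
move=> ltD [Psi [hPsi HD]]; exists Psi; split=> //.
apply: (max_destabilizing_saturated hT hPsi dH); first by rewrite hM.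
exact: defect_saturated hPsi _ _ HD.
Qed.

Lemma destabilized_iff_defect i D : in_Ub K T b g D ->
  destabilized_by T theta a b M H i D <-> has_defect T theta a b M H i D.
Proof.
move=> [effD leD ltD]; split; last exact: defect_destabilized.
move=> [Psi [hPsi [HU _ _]]]; exists Psi; split=> //.
apply: (saturated_defect hT hc hPsi) => // v.
by rewrite effD leD.
Qed.

Lemma summand_degrees i D : deg D < g%:Z - 1 ->
  deg (S i - D) + deg (S i - K + D) = 0 /\ 0 < deg (S i - D).
Proof.
move=> ltD; have [_ dK] := hK.
by rewrite !(degD, degN) !(deg_summand M hT) hM dK; split; lia.
Qed.

Lemma destabilized_limit i D s : in_Ub K T b g D -> has_zero_div D s D ->
  destabilized_by T theta a b M H i D ->
  exists H0 : higgs K, [/\ hbundle H0 = dsum (S i - D) (S i - K + D),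
    hfield H0 = s ^+ 2 *: delta_mx 1 0 & is_limit H H0].
Proof.
move=> UD [s0 os] /(destabilized_iff_defect _ UD)[Psi [hPsi HD]].
have [effD _ ltD] := UD.
have {}os v : ord v s = 0 by apply: (addIr (coeff v D)); rewrite add0r; exact: os.
have HF : is_higgs_field K (dsum (S i - D) (S i - K + D)) (s ^+ 2 *: delta_mx 1 0).
  apply: dsum_higgs_field => v; rewrite ordXn os !(coeffD, coeffN).
  rewrite [X in _ <= X](_ : _ = coeff v D + coeff v D); last by ring.
  by apply: addr_ge0; exact: effD.
have [deg01 gt0] := summand_degrees i ltD.
exists (Higgs HF); split=> //; apply: degenerates_limit.
  exact: (directions_degenerate hT hc hPsi HD s0 os).
have s20 : s ^+ 2 != 0 by rewrite expf_neq0.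
apply: stable_in_moduli; first by rewrite bdeg_dsum.
exact: (stable_fixed s20 deg01 gt0).
Qed.

Lemma destabilized_wobbly i D s : in_Ub K T b g D -> D != 0 -> has_zero_div D s D ->
  destabilized_by T theta a b M H i D -> tends_to_wobbly H (S i) D s.
Proof.
move=> UD D0 sD dest; have [H0 [bH0 fH0 lim]] := destabilized_limit UD sD dest.
exists H0; split=> //; have [effD _ ltD] := UD; have [s0 os] := sD.
have [deg01 gt0] := summand_degrees i ltD.
have s20 : s ^+ 2 != 0 by rewrite expf_neq0.
have [v Dv] : exists v, coeff v D != 0.
  apply: contrapT => no; move/eqP: D0; apply; apply/eqP/freeg_eqP => v.
  by rewrite coeff0; apply/eqP; apply: contrapT => /negP Dv; apply: no; exists v.
apply: (wobbly11 s20 deg01 gt0 bH0 fH0 (v0 := v)).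
have os0 : ord v s = 0 by apply: (addIr (coeff v D)); rewrite add0r; exact: os.
rewrite ordXn os0 !(coeffD, coeffN) [X in _ <= X](_ : _ = coeff v D + coeff v D); last by ring.
have Dv1 : 1 <= coeff v D by rewrite -gtz0_ge1 lt_neqAle eq_sym Dv effD.
exact: (lerD Dv1 Dv1).
Qed.

Lemma zero_in_Ub : in_Ub K T b g 0.
Proof.
split=> [v|v|]; rewrite ?coeff0 ?lexx //; first exact: (div_b_ge0 hT hc).
by rewrite deg0; move: hg; lia.
Qed.

Lemma destabilized_very_stable i : destabilized_by T theta a b M H i 0 ->
  exists H0, is_limit H H0 /\ very_stable H0.
Proof.
have s1 : has_zero_div (0 : divisor X) (1 : F) 0.
  by split=> [|v]; rewrite ?oner_neq0 // /zero_div ord_one coeff0 addr0.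
move=> dest; have [H0 [bH0 fH0 lim]] := destabilized_limit zero_in_Ub s1 dest.
exists H0; split=> //; have [_ _ lt0] := zero_in_Ub.
have [deg01 gt0] := summand_degrees i lt0.
apply: (very_stable11 _ deg01 gt0 bH0 fH0); first by rewrite expr1n oner_neq0.
move=> v; rewrite expr1n ord_one !(coeffD, coeffN) coeff0; ring.
Qed.

Lemma semistable_no_defect i D : semistable_bundle H -> in_Ub K T b g D ->
  ~ has_defect T theta a b M H i D.
Proof.
move=> ssH [_ _ ltD] /(defect_destabilized ltD)[Psi [_ [HU gt _]]].
by have := ssH _ _ HU; rewrite leNgt gt.
Qed.

Lemma semistable_wobbly : semistable_bundle H -> is_limit H (zero_higgs K H) /\ wobbly_bundle K H.
Proof.
move=> ssH; split; first exact: semistable_limit.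
by split=> //; have [_ _ [Psi hPsi]] := hH; exact: (nilpotent_higgs_ex hT hc hPsi).
Qed.

Lemma in_VE D : in_V T theta a b M H D <-> has_defect T theta a b M H 0 D.
Proof. by split=> [[]|]. Qed.

Lemma in_V'E D : in_V' T theta a b M H D <-> has_defect T theta a b M H 1 D.
Proof. by split=> [[]|]. Qed.

End MainParts.

Theorem theorem4p16 (R : realType) (X : curve R) (g : nat) (hg : (1 < g)%N)
    (K : divisor X) (hK : has_genus g K)
    (T : divisor X) (theta : fun_field X) (hT : is_2torsion T theta)
    (M : divisor X) (hM : deg M = g%:Z - 1)
    (a b : fun_field X) (hc : in_BTni K T theta a b)
    (H : higgs K) (hH : in_SMT T theta a b M H) :
  (semistable_bundle H ->
     (forall D, in_Ub K T b g D ->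
        ~ in_V T theta a b M H D /\ ~ in_V' T theta a b M H D) /\
     is_limit H (zero_higgs K H) /\ wobbly_bundle K H)
  /\
  (forall (D : divisor X) (s : fun_field X),
     in_Ub K T b g D -> D != 0 -> has_zero_div D s D ->
     (destabilized_by T theta a b M H 0 D <-> in_V T theta a b M H D) /\
     (destabilized_by T theta a b M H 0 D -> tends_to_wobbly H M D s) /\
     (destabilized_by T theta a b M H 1 D <-> in_V' T theta a b M H D) /\
     (destabilized_by T theta a b M H 1 D -> tends_to_wobbly H (M + T) D s))
  /\
  ((destabilized_by T theta a b M H 0 0 <-> in_V T theta a b M H 0) /\
   (destabilized_by T theta a b M H 1 0 <-> in_V' T theta a b M H 0) /\
   (destabilized_by T theta a b M H 0 0 \/ destabilized_by T theta a b M H 1 0 ->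
    exists H0, is_limit H H0 /\ very_stable H0)).
Proof.
split; [|split].
- move=> ssH; split; last exact: (semistable_wobbly hT hc hH).
  move=> D UD; split=> [/(in_VE hH) hD|/(in_V'E hH) hD];
    exact: (semistable_no_defect hT hM hc hH ssH UD hD).
- move=> D s UD D0 sD; split; [|split; [|split]].
  + by rewrite (in_VE hH); exact: (destabilized_iff_defect hT hM hc hH).
  + exact: (destabilized_wobbly hg hK hT hM hc hH UD D0 sD).
  + by rewrite (in_V'E hH); exact: (destabilized_iff_defect hT hM hc hH).
  + exact: (destabilized_wobbly hg hK hT hM hc hH UD D0 sD).
split; [|split].
- rewrite (in_VE hH); apply: (destabilized_iff_defect hT hM hc hH).
  exact: (zero_in_Ub hg hT hM hc hH).
- rewrite (in_V'E hH); apply: (destabilized_iff_defect hT hM hc hH).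
  exact: (zero_in_Ub hg hT hM hc hH).
by case=> dest; exact: (destabilized_very_stable hg hK hT hM hc hH dest).
Qed.
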